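(* Let $m \in \{0, 1, 2, \ldots\}$ and let $f$ be a function on $(0, \infty)$. The following conditions are equivalent: (a) $f$ is a whale-shaped function of order $m$, integrable near $0$ if $m = 0$; (b) $f$ is the convolution of $m$ exponential factors of the form $\alpha_j^{-1} \exp(-x / \alpha_j)$ on $(0,\infty)$, with $\alpha_j > 0$, $j = 1, 2, \ldots, m$, and a (not identically zero) completely monotone function on $(0, \infty)$ which converges to zero at $\infty$ and which is integrable near $0$. In particular, every whale-shaped function of order $m$ (integrable near $0$ if $m = 0$), extended by zero to $(-\infty, 0]$, is weakly bell-shaped.
   Context: A real function $u$ on an interval changes its sign $N$ times if $N$ is the largest integer for which there are $x_0 < \dots < x_N$ in that interval with $u(x_{j-1}) u(x_j) < 0$ for $j = 1, \dots, N$ (and $N=0$ if $u$ does not take both signs). A function $f$ on $(0, \infty)$ is whale-shaped of order $m \in \{0, 1, 2, \ldots\}$ if $f$ is positive and smooth, $f$ converges to zero at $\infty$, $f^{(n)}$ converges to zero at $0$ for $n = 0, 1, \ldots, m - 1$, and $f^{(n)}$ changes its sign $\min\{n, m\}$ times for $n = 0, 1, 2, \ldots$ Convolution of functions on $(0, \infty)$ is $(u * v)(x) = \int_0^x u(x-y) v(y)\, dy$. A smooth function $f : \mathbb{R} \to [0, \infty)$ is strictly bell-shaped if $f(x) \to 0$ as $x \to \pm\infty$ and for every $n = 0, 1, 2, \ldots$ the derivative $f^{(n)}$ changes its sign exactly $n$ times. Let $G_t(x) = (4 \pi t)^{-1/2} e^{-x^2/(4t)}$. A non-negative Borel measure $f$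 on $\mathbb{R}$ (a function being identified with the measure with that density) is weakly bell-shaped if for every $t > 0$ the convolution $(f * G_t)(x) = \int_{\mathbb{R}} G_t(x-y) f(dy)$ is a (finite) strictly bell-shaped function. *)

(* Defs.v *)
From HB Require Import structures.
From mathcomp Require Export all_boot all_order all_algebra.
From mathcomp Require Export all_classical all_reals all_analysis.

Set Implicit Arguments.
Unset Strict Implicit.
Unset Printing Implicit Defensive.

Export Order.TTheory GRing.Theory Num.Theory.
Export numFieldNormedType.Exports.

Local Open Scope classical_set_scope.
Local Open Scope ring_scope.

(* A function on (0, oo) is represented by a function R -> R of which only the
   values on `]0, +oo[ are used. Since (0, oo) is open, the total derivatives
   [derive1n n f] at points of (0, oo) depend on these values only. *)

Definition sign_alternates (R : realType) (I : set R) (u : R -> R) (N : nat) :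
    Prop :=
  exists x : nat -> R,
    [/\ forall j : nat, (j <= N)%N -> I (x j),
        forall j : nat, (j < N)%N -> x j < x j.+1 &
        forall j : nat, (j < N)%N -> u (x j) * u (x j.+1) < 0].

(* On a nonempty I, [sign_alternates I u 0] always holds, so N = 0 exactly when
   u does not take both signs. *)
Definition changes_sign (R : realType) (I : set R) (u : R -> R) (N : nat) :
    Prop :=
  sign_alternates I u N /\
  forall M : nat, sign_alternates I u M -> (M <= N)%N.

Definition smooth_on (R : realType) (I : set R) (f : R -> R) : Prop :=
  forall (n : nat) (x : R), I x -> derivable (derive1n n f) x 1.

Definition whale_shaped (R : realType) (m : nat) (f : R -> R) : Prop :=
  [/\ forall x : R, 0 < x -> 0 < f x,
      smooth_on `]0, +oo[ f,
      f x @[x --> +oo] --> (0 : R),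
      forall n : nat, (n < m)%N -> derive1n n f x @[x --> 0^'+] --> (0 : R) &
      forall n : nat, changes_sign `]0, +oo[ (derive1n n f) (minn n m)].

Definition completely_monotone (R : realType) (g : R -> R) : Prop :=
  smooth_on `]0, +oo[ g /\
  forall (n : nat) (x : R), 0 < x -> 0 <= (-1) ^+ n * derive1n n g x.

Definition integrable_near0 (R : realType) (f : R -> R) : Prop :=
  exists2 e : R, 0 < e &
    (@lebesgue_measure R).-integrable `]0, e[ (EFin \o f).

Definition conv (R : realType) (u v : R -> R) (x : R) : R :=
  \int[@lebesgue_measure R]_(y in `]0, x[) (u (x - y) * v y).

Definition exp_factor (R : realType) (a : R) (x : R) : R :=
  a^-1 * expR (- x / a).

Definition conv_exp_factors (R : realType) (s : seq R) (g : R -> R) : R -> R :=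
  foldr (fun a h => conv (exp_factor a) h) g s.

Definition strictly_bell_shaped (R : realType) (f : R -> R) : Prop :=
  [/\ forall x : R, 0 <= f x,
      smooth_on setT f,
      f x @[x --> +oo] --> (0 : R),
      f x @[x --> -oo] --> (0 : R) &
      forall n : nat, changes_sign setT (derive1n n f) n].

Definition gauss_kernel (R : realType) (t x : R) : R :=
  (Num.sqrt (4 * pi * t))^-1 * expR (- x ^+ 2 / (4 * t)).

Definition conv_gauss (R : realType)
    (nu : {measure set (measurableTypeR R) -> \bar R}) (t x : R) : \bar R :=
  (\int[nu]_y (gauss_kernel t (x - y)%R)%:E)%E.

Definition weakly_bell_shaped (R : realType)
    (nu : {measure set (measurableTypeR R) -> \bar R}) : Prop :=
  forall t : R, 0 < t ->
    (forall x : R, conv_gauss nu t x \is a fin_num) /\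
    strictly_bell_shaped (fun x => fine (conv_gauss nu t x)).

Definition has_density (R : realType)
    (nu : {measure set (measurableTypeR R) -> \bar R}) (f : R -> R) : Prop :=
  [/\ forall x : R, 0 <= f x,
      measurable_fun (setT : set (measurableTypeR R)) f &
      forall A : set (measurableTypeR R), measurable A ->
        (nu A = \int[@lebesgue_measure R]_(x in A) (f x)%:E)%E].

(* The measure with density f is unique on Borel sets. *)
Definition weakly_bell_shaped_fun (R : realType) (f : R -> R) : Prop :=
  exists2 nu : {measure set (measurableTypeR R) -> \bar R},
    has_density nu f & weakly_bell_shaped nu.

(* Main.v *)
From HB Require Import structures.
Require Import Defs.
From mathcomp Require Import ring lra measurable_realfun.

(* (b) => (a): if h is the convolution of u with the exponential factor of
   parameter a, then h + a h' = u, so expR (x / a) * h^(n) is a primitive of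
   expR (x / a) * u^(n) / a, and by Rolle's theorem h^(n) changes its sign at
   most once more than u^(n).

   (a) => (b): let f be whale-shaped of order m + 1 and let x_n be a sign
   change of f^(n) for n > m. The (n-1)-st derivative of
   (n - 1) f + (x_n - x) f' is (x_n - x) f^(n), which changes its sign at most
   m times; by Rolle's theorem so do the lower derivatives. Dividing by
   n - 1 + x_n and passing to a cluster point gives l in [0, 1] such that all
   derivatives of (1 - l) f + l f' change their sign at most m times, and
   0 < l < 1 because f^(m+1) changes its sign m + 1 times. With a = l / (1 - l),
   the function f + a f' is whale-shaped of order m, and f is its convolution
   with the exponential factor of parameter a. In order 0 all the derivatives have constant sign.

   Bell shape: the convolution of f with q^2 + 1 exponential factors of parameter
   s / q is whale-shaped of order m + q^2 + 1, and, shifted by q s, tends to the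
   convolution of f with a Gaussian as q grows. Finite differences carry the upper bound
   n on the number of sign changes of the n-th derivative to the limit, and
   Rolle's theorem gives the lower bound. *)

Set Implicit Arguments.
Unset Strict Implicit.
Unset Printing Implicit Defensive.

Local Open Scope classical_set_scope.
Local Open Scope ring_scope.

(** * Sign changes and Rolle's theorem *)

(** Decay at infinity is assumed for f alone, not for its derivatives. At the right end Rolle's
    theorem needs only one small value beyond each point, and unit-step finite differences of f,
    which tend to zero and are values of f^(n), supply it. So differentiation never loses sign
    changes, and below order m the zero at the left end gains one. The multiplier x_n - x is
    unbounded; (x_n - x) f' still vanishes at infinity because f' is eventually monotone, which
    makes Rolle's theorem available from the very first derivative. Nothing controls the size of
    x_n, hence the division by n - 1 + x_n, which leaves two weights of sum 1. With q^2 + 1 factors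
    of parameter s / q the variance stays near s^2 while the order grows with q: once it exceeds n,
    the n-th derivative has at most n sign changes. The convergence to the Gaussian convolution is
    only pointwise, so derivatives are replaced by finite differences, which see values only. *)

Definition upclosed (R : realType) (I : set R) : Prop :=
  forall x y, I x -> x <= y -> I y.

(** Derivatives are kept as an explicit sequence, so that combinations such as
    [D n x + a * D n.+1 x] are again families without any computation of [derive1n]. *)
Definition der_family (R : realType) (I : set R) (D : nat -> R -> R) : Prop :=
  forall (n : nat) (x : R), I x -> is_derive x 1 (D n) (D n.+1 x).

Lemma upclosed_pos (R : realType) : upclosed (`]0, +oo[ : set R).
Proof. by move=> x y; rewrite /= !in_itv/= !andbT => x0 /(lt_le_trans x0). Qed.

Lemma is_derive_continuous (R : realType) (u : R -> R) (x d : R) :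
  is_derive x 1 u d -> {for x, continuous u}.
Proof. by move=> [du _]; apply/differentiable_continuous/derivable1_diffP. Qed.

(** Closure of [I] to the right keeps the mean-value point inside [I]; this treats []0, +oo[] and
    [setT] at once. *)
Lemma mvt_upclosed (R : realType) (I : set R) (u du : R -> R) (a b : R) :
  upclosed I -> (forall x, I x -> is_derive x 1 u (du x)) ->
  I a -> a < b ->
  exists c, [/\ a < c, c < b & u b - u a = du c * (b - a)].
Proof.
move=> upI dI Ia ab.
have [| |c] := @MVT R u du a b ab.
- by move=> x; rewrite in_itv/= => /andP[/ltW ax _]; exact/dI/(upI _ _ Ia).
- apply: derivable_within_continuous => x; rewrite in_itv/= => /andP[ax _].
  by have [] := dI x (upI _ _ Ia ax).
- by rewrite in_itv/= => /andP[ac cb] E; exists c.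
Qed.

(* [N] sign changes, with [s] carrying the sign of the first value: this form
   is meaningful for [N = 0], unlike [sign_alternates]. *)
Definition alternates (R : realType) (I : set R) (u : R -> R) (N : nat) (s : R)
    : Prop :=
  exists x : nat -> R,
    [/\ forall j : nat, (j <= N)%N -> I (x j),
        forall j : nat, (j < N)%N -> x j < x j.+1 &
        forall j : nat, (j <= N)%N -> 0 < s * (-1) ^+ j * u (x j)].

Lemma alternates_sign (R : realType) (I : set R) (u : R -> R) N s :
  alternates I u N s -> sign_alternates I u N.
Proof.
move=> [x [Ix ltx sx]]; exists x; split => // j jN.
have := mulr_gt0 (sx _ (ltnW jN)) (sx _ jN).
rewrite exprS => h.
have : 0 < - (u (x j) * u (x j.+1)) * (s * (-1) ^+ j) ^+ 2.
  by move: h; congr (0 < _); ring.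
have [->|sn0] := eqVneq (s * (-1) ^+ j) 0.
  by rewrite expr0n/= mulr0 ltxx.
by rewrite pmulr_lgt0 ?oppr_gt0// exprn_even_gt0.
Qed.

Lemma sign_alternates_alternates (R : realType) (I : set R) (u : R -> R) N :
  sign_alternates I u N.+1 -> exists s, alternates I u N.+1 s.
Proof.
move=> [x [Ix ltx sx]]; exists (u (x 0)), x; split => //.
elim=> [_|j IH jN].
  rewrite expr0 mulr1 -expr2 exprn_even_gt0//=; apply/eqP => u0.
  by have := sx 0%N isT; rewrite u0 mul0r ltxx.
have := IH (ltnW jN); have := sx _ jN.
rewrite exprS; set a := u (x j); set b := u (x j.+1).
set c := u (x 0) * (-1) ^+ j => ab ca.
have -> : u (x 0) * (-1 * (-1) ^+ j) * b = - (c * b) by rewrite /c; ring.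
have : 0 < (c * a) * - (a * b) by rewrite mulr_gt0// oppr_gt0.
have -> : c * a * - (a * b) = - (c * b) * a ^+ 2 by ring.
rewrite pmulr_lgt0// exprn_even_gt0//=; apply/eqP => a0.
by move: ab; rewrite a0 mul0r ltxx.
Qed.

Lemma sign_alternates_le (R : realType) (I : set R) (u : R -> R) M N :
  (M <= N)%N -> sign_alternates I u N -> sign_alternates I u M.
Proof.
move=> MN [x [Ix ltx sx]]; exists x; split => j jM.
- exact/Ix/(leq_trans jM).
- exact/ltx/(leq_trans jM).
- exact/sx/(leq_trans jM).
Qed.

Lemma alternates_mulpos (R : realType) (I : set R) (w u v : R -> R) N s :
  (forall x, I x -> 0 < w x) -> (forall x, I x -> v x = w x * u x) ->
  alternates I v N s <-> alternates I u N s.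
Proof.
move=> w0 vE; split=> -[x [Ix ltx sx]]; exists x; split => // j jN.
  have := sx _ jN; rewrite vE; last exact: Ix.
  by rewrite mulrCA pmulr_rgt0//; exact/w0/Ix.
rewrite vE; last exact: Ix.
by rewrite mulrCA pmulr_rgt0; [exact: sx|exact/w0/Ix].
Qed.

Lemma alternates_opp (R : realType) (I : set R) (u : R -> R) N s :
  alternates I u N s -> alternates I (fun x => - u x) N (- s).
Proof.
move=> [x [Ix ltx sx]]; exists x; split => // j jN.
by rewrite mulNr mulrNN; exact: sx.
Qed.

(** Common core of the three Rolle lemmas below, which differ only in the end points added to the
    given sequence. *)
Lemma mvt_alternates (R : realType) (I : set R) (u du : R -> R) N s
    (x : nat -> R) :
  upclosed I -> (forall x, I x -> is_derive x 1 u (du x)) ->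
  I (x 0) -> (forall j, (j <= N)%N -> x j < x j.+1) ->
  (forall j, (j <= N)%N -> 0 < s * (-1) ^+ j * (u (x j.+1) - u (x j))) ->
  alternates I du N s.
Proof.
move=> upI dI I0 ltx sx.
have Ix j : (j <= N.+1)%N -> I (x j).
  elim: j => // j IH jN; apply: upI (IH (ltnW jN)) _; exact/ltW/ltx.
have /choice[c cP] : forall j, exists c, (j <= N)%N ->
    [/\ x j < c, c < x j.+1 & 0 < s * (-1) ^+ j * du c].
  move=> j; have [jN|_] := leqP j N; last by exists 0.
  have [c [xc cx E]] := mvt_upclosed upI dI (Ix _ (leqW jN)) (ltx _ jN).
  exists c => _; split => //; have := sx _ jN.
  by rewrite E mulrA pmulr_lgt0// subr_gt0 ltx.
exists c; split => j jN.
- by have [/ltW h _ _] := cP j jN; apply: upI h; exact/Ix/leqW.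
- have [_ h _] := cP j (ltnW jN); have [h' _ _] := cP j.+1 jN.
  exact: lt_trans h h'.
- by have [] := cP j jN.
Qed.

(** Weaker than a limit: one small value beyond each point is enough for Rolle's theorem, and it is
    available for derivatives whose limit is unknown. *)
Definition vanishes_left (R : realType) (I : set R) (u : R -> R) : Prop :=
  forall x e : R, I x -> 0 < e -> exists y, [/\ I y, y < x & `|u y| < e].

Definition vanishes_right (R : realType) (I : set R) (u : R -> R) : Prop :=
  forall x e : R, I x -> 0 < e -> exists y, [/\ I y, x < y & `|u y| < e].

Lemma rolle_alternates (R : realType) (I : set R) (u du : R -> R) N s :
  upclosed I -> (forall x, I x -> is_derive x 1 u (du x)) ->
  alternates I u N.+1 s -> alternates I du N (- s).
Proof.
move=> upI dI [x [Ix ltx sx]].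
apply: (mvt_alternates (x := x) upI dI (Ix 0%N isT)) => // j jN.
have := sx _ (leqW jN); have := sx _ (jN : (j < N.+1)%N).
rewrite exprS; set p := (-1) ^+ j; lra.
Qed.

Lemma gt_mul_norm (R : realType) (s a b : R) :
  0 < s * a -> `|b| < `|a| -> s * b < s * a.
Proof.
move=> sa ba; rewrite -(gtr0_norm sa) normrM; apply: le_lt_trans (ler_norm _) _.
rewrite normrM ltr_pM2l// normr_gt0; apply/eqP => s0.
by move: sa; rewrite s0 mul0r ltxx.
Qed.

(** A last point where [u] is smaller in absolute value than at [x N] yields one more increment, so
    no sign change is lost. *)
Lemma rolle_alternates_right (R : realType) (I : set R) (u du : R -> R) N s :
  upclosed I -> (forall x, I x -> is_derive x 1 u (du x)) ->
  vanishes_right I u ->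
  alternates I u N s -> alternates I du N (- s).
Proof.
move=> upI dI vr [x [Ix ltx sx]].
have xN0 : 0 < `|u (x N)|.
  rewrite normr_gt0; apply/eqP => u0.
  by have := sx N (leqnn _); rewrite u0 mulr0 ltxx.
have [y [Iy xy uy]] := vr _ _ (Ix N (leqnn _)) xN0.
apply: (mvt_alternates (x := fun j => if (j <= N)%N then x j else y) upI dI).
- exact: Ix.
- move=> j jN; rewrite jN; case: ifP => [|/negbT]; first exact: ltx.
  by rewrite -leqNgt => Nj; have -> : j = N by apply/eqP; rewrite eqn_leq jN.
move=> j jN; rewrite jN; case: ifP => [jN'|/negbT].
  have := sx _ jN; have := sx _ jN'.
  rewrite exprS; set p := (-1) ^+ j; lra.
rewrite -leqNgt => Nj; have -> : j = N by apply/eqP; rewrite eqn_leq jN.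
have := gt_mul_norm (sx N (leqnn _)) uy; lra.
Qed.

(** Extra points on both sides give two more increments than [rolle_alternates] has. The first one
    leads up to [x 0], hence the sign [s] and not [- s]. *)
Lemma rolle_alternates_both (R : realType) (I : set R) (u du : R -> R) N s :
  upclosed I -> (forall x, I x -> is_derive x 1 u (du x)) ->
  vanishes_left I u -> vanishes_right I u ->
  alternates I u N s -> alternates I du N.+1 s.
Proof.
move=> upI dI vl vr [x [Ix ltx sx]].
have n0 j : (j <= N)%N -> 0 < `|u (x j)|.
  move=> jN; rewrite normr_gt0; apply/eqP => u0.
  by have := sx j jN; rewrite u0 mulr0 ltxx.
have [y [Iy xy uy]] := vr _ _ (Ix N (leqnn _)) (n0 N (leqnn _)).
have [z [Iz zx uz]] := vl _ _ (Ix 0%N isT) (n0 0%N isT).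
apply: (mvt_alternates (x := fun j => if j is j'.+1 then
   if (j' <= N)%N then x j' else y else z) upI dI) => //=.
- case=> //= j jN; rewrite ltnS in jN; rewrite jN.
  case: ifP => [|/negbT]; first exact: ltx.
  by rewrite -leqNgt => Nj; have -> : j = N by apply/eqP; rewrite eqn_leq jN.
- case=> [_|j jN].
    have := sx 0%N isT; rewrite expr0 mulr1 => sx0.
    by have := gt_mul_norm sx0 uz; lra.
  rewrite ltnS in jN; rewrite jN; case: ifP => [jN'|/negbT].
    have := sx _ jN; have := sx _ jN'.
    rewrite exprS; set p := (-1) ^+ j; lra.
  rewrite -leqNgt => Nj; have -> : j = N by apply/eqP; rewrite eqn_leq jN.
  have := gt_mul_norm (sx N (leqnn _)) uy; rewrite exprS; lra.
Qed.

(** * Finite differences and behaviour at the ends *)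

Fixpoint fin_diff (R : realType) (n : nat) (d : R) (u : R -> R) (y : R) : R :=
  if n is n'.+1 then fin_diff n' d u (y + d) - fin_diff n' d u y else u y.

Lemma fin_diffS (R : realType) (n : nat) (d : R) (u : R -> R) (y : R) :
  fin_diff n.+1 d u y = fin_diff n d (fun z => u (z + d) - u z) y.
Proof. by elim: n y => // n IH y; rewrite [RHS]/= -!IH. Qed.

(** The induction hypothesis is applied to the family of differences [D k (z + d) - D k z]; one more
    mean value theorem turns its [n]-th member into [d * D n.+1 c]. *)
Lemma fin_diff_mvt (R : realType) (I : set R) (D : nat -> R -> R) n (d y : R) :
  upclosed I -> der_family I D -> I y -> 0 < d ->
  exists z, [/\ y <= z, z <= y + d *+ n & fin_diff n d (D 0) y = d ^+ n * D n z].
Proof.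
move=> upI + Iy d0; elim: n D => [|n IH] D dD.
  by exists y; rewrite mulr0n addr0 lexx expr0 mul1r.
have dD' : der_family I (fun k z => D k (z + d) - D k z).
  move=> k x Ix; apply: is_deriveB; last exact: dD.
  have Ixd : I (x + d) by apply: upI Ix _; rewrite lerDl ltW.
  have := is_derive_shift x (1 : R) d.
  have := dD k (x + d) Ixd => h1 h2.
  have := @is_derive1_comp _ (D k) (shift d) x _ _ h1 h2.
  by rewrite mulr1.
have [z [yz zy E]] := IH _ dD'.
have Iz : I z by exact: upI Iy yz.
have zd : z < z + d by rewrite ltrDl.
have [c [zc cz E']] := mvt_upclosed upI (dD n) Iz zd.
exists c; split.
- exact: le_trans yz (ltW zc).
- by rewrite mulrSr addrA; apply: le_trans (ltW cz) _; rewrite lerD2r.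
- by rewrite fin_diffS E E' exprSr; ring.
Qed.

Lemma cvg_fin_diff (R : realType) (T : Type) (F : set_system T) {FF : Filter F}
    (u_ : T -> R -> R) (u : R -> R) n d y :
  (forall x, u_ t x @[t --> F] --> u x) ->
  fin_diff n d (u_ t) y @[t --> F] --> fin_diff n d u y.
Proof. by move=> uu; elim: n y => //= n IH y; apply: cvgB. Qed.

Lemma cvg0_fin_diff_shift (R : realType) (F : set_system R) {FF : Filter F}
    (u : R -> R) n :
  (forall a : R, u (x + a) @[x --> F] --> (0 : R)) ->
  fin_diff n 1 u x @[x --> F] --> (0 : R).
Proof.
move=> u0; suff h k a : fin_diff k 1 u (x + a) @[x --> F] --> (0 : R).
  by have := h n 0; under eq_fun do rewrite addr0.
elim: k a => [a|k IH a] /=; first exact: u0.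
rewrite -[X in _ --> X](subrr 0); apply: cvgB; last exact: IH.
by under eq_fun do rewrite -addrA; exact: IH.
Qed.

(** The [n]-th difference of step 1 of [D 0] tends to zero and equals a value of [D n] at a point
    further right. *)
Lemma vanishes_right_family (R : realType) (I : set R) (D : nat -> R -> R) n :
  upclosed I -> der_family I D -> D 0 x @[x --> +oo] --> (0 : R) ->
  vanishes_right I (D n).
Proof.
move=> upI dD D0 x e Ix e0.
have : fin_diff n 1 (D 0) y @[y --> +oo] --> (0 : R).
  apply: cvg0_fin_diff_shift => a; apply: cvg_comp D0.
  exact: cvg_addrr.
move=> /cvgr0_norm_lt/(_ _ e0)/(pinfty_ex_gt (num_real x))[M xM fdM].
have [z [Mz _ E]] := fin_diff_mvt n upI dD (upI _ _ Ix (ltW xM)) ltr01.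
have xz := lt_le_trans xM Mz.
exists z; split; [exact: upI (ltW xz)|exact: xz|].
by move: fdM; rewrite E expr1n mul1r.
Qed.

Lemma vanishes_left_family (R : realType) (D : nat -> R -> R) n :
  der_family setT D -> D 0 x @[x --> -oo] --> (0 : R) ->
  vanishes_left setT (D n).
Proof.
move=> dD D0 x e _ e0.
have : fin_diff n 1 (D 0) y @[y --> -oo] --> (0 : R).
  apply: cvg0_fin_diff_shift => a; apply: cvg_comp D0.
  exact: cvg_addrr_Ny.
move=> /cvgr0_norm_lt/(_ _ e0) fd0.
near (ninfty_nbhs R) => M.
(* The point given by the mean value theorem may be as far right as [M + n]. *)
have xM : M < x - n%:R by near: M; apply: nbhs_ninfty_lt; exact: num_real.
have fdM : `|fin_diff n 1 (D 0) M| < e by near: M.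
have upT : upclosed (setT : set R) by [].
have [z [Mz zM E]] := fin_diff_mvt n upT dD (I : setT M) ltr01.
exists z; split => //.
  by apply: le_lt_trans zM _; rewrite -ltrBrDr.
by move: fdM; rewrite E expr1n mul1r.
Unshelve. all: by end_near. Qed.

Lemma cvg0_vanishes_left_pos (R : realType) (u : R -> R) :
  u x @[x --> 0^'+] --> (0 : R) -> vanishes_left `]0, +oo[ u.
Proof.
move=> u0 x e; rewrite /= in_itv/= andbT => x0 e0.
near (0 : R)^'+ => y; exists y; split.
- by rewrite in_itv/= andbT; near: y; exact: nbhs_right_gt.
- by near: y; exact: nbhs_right_lt.
- by near: y; apply: cvgr0_norm_lt.
Unshelve. all: by end_near. Qed.

Lemma pos_itv (R : realType) (x : R) : `]0, +oo[%classic x = (0 < x).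
Proof. by rewrite /= in_itv/= andbT. Qed.

(* Otherwise both signs occur arbitrarily far to the right. *)
Lemma eventually_signed (R : realType) (u : R -> R) N :
  (forall s, ~ alternates `]0, +oo[ u N s) ->
  exists X : R, 0 < X /\ exists2 s : R, (s = 1 \/ s = -1) & 
    forall x : R, X < x -> 0 <= s * u x.
Proof.
move=> nalt; apply: contrapT => nX.
have sgn k : (-1) ^+ k = 1 :> R \/ (-1) ^+ k = -1 :> R.
  by rewrite -signr_odd; case: (odd k); [right|left].
have /choice[g gP] : forall p : nat * R, exists x,
    0 < p.2 -> p.2 < x /\ 0 < (-1) ^+ p.1 * u x.
  move=> [k X] /=; have [X0|X0] := ltP 0 X; last by exists 0.
  apply: contrapT => nx; apply: nX; exists X; split => //.
  exists (- (-1) ^+ k) => [|x Xx].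
    by case: (sgn k) => ->; [right|left]; rewrite ?opprK.
  rewrite mulNr oppr_ge0 leNgt; apply/negP => h; apply: nx.
  by exists x => _.
pose x := fix x j := if j is j'.+1 then g (j, x j') else g (0%N, 1).
have xP j : 0 < x j /\ 0 < (-1) ^+ j * u (x j).
  elim: j => [|j [xj0 _]] /=.
    by have [/(lt_trans ltr01)] := gP (0%N, 1) ltr01.
  by have [/(lt_trans xj0)] := gP (j.+1, x j) xj0.
apply: (nalt 1); exists x; split => j jN.
- by rewrite pos_itv; have [] := xP j.
- by have [] := gP (j.+1, x j) (xP j).1.
- by rewrite mul1r; have [] := xP j.
Qed.

Lemma cvg0M (R : realType) (T : Type) (F : set_system T) {FF : Filter F}
    (u : T -> R) (k : R) :
  u t @[t --> F] --> (0 : R) -> k * u t @[t --> F] --> (0 : R).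
Proof. by move=> u0; rewrite -[X in _ --> X](mulr0 k); apply: cvgMl_tmp. Qed.

Lemma cvg0B (R : realType) (T : Type) (F : set_system T) {FF : Filter F}
    (u v : T -> R) :
  u t @[t --> F] --> (0 : R) -> v t @[t --> F] --> (0 : R) ->
  u t - v t @[t --> F] --> (0 : R).
Proof. by move=> u0 v0; rewrite -[X in _ --> X](subrr 0); apply: cvgB. Qed.

Lemma cvg0D (R : realType) (T : Type) (F : set_system T) {FF : Filter F}
    (u v : T -> R) :
  u t @[t --> F] --> (0 : R) -> v t @[t --> F] --> (0 : R) ->
  u t + v t @[t --> F] --> (0 : R).
Proof. by move=> u0 v0; rewrite -[X in _ --> X](addr0 0); apply: cvgD. Qed.

(* [D 1] is eventually monotone, so [x * D 1 x] lies between
   [2 * (D 0 x - D 0 (x / 2))] and [D 0 (2 * x) - D 0 x]. *)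
Lemma cvg_mul_derive_pinfty (R : realType) (D : nat -> R -> R) N :
  der_family `]0, +oo[ D -> D 0 x @[x --> +oo] --> (0 : R) ->
  (forall s, ~ alternates `]0, +oo[ (D 2) N s) ->
  x * D 1 x @[x --> +oo] --> (0 : R).
Proof.
move=> dD D0 /eventually_signed[X [X0 [s s1 sD]]].
have d x := dD 0%N x; have d1 x := dD 1%N x.
have sD1 x y : X < x -> x <= y -> s * D 1 x <= s * D 1 y.
  move=> Xx; rewrite le_eqVlt => /predU1P[->//|xy].
  have [|c [xc cy E]] := mvt_upclosed (@upclosed_pos R) d1 _ xy.
    by rewrite pos_itv (lt_trans X0).
  rewrite -subr_ge0 -mulrBr E mulrA mulr_ge0// ?subr_ge0 ?(ltW xy)//.
  exact/sD/(lt_trans Xx).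
have ub x : X < x -> s * (x * D 1 x) <= s * (D 0 (2 * x) - D 0 x).
  move=> Xx; have x0 := lt_trans X0 Xx.
  have [||c [xc cy ->]] := @mvt_upclosed _ _ _ _ x (2 * x) (@upclosed_pos R) d.
  - by rewrite pos_itv.
  - lra.
  have -> : 2 * x - x = x by ring.
  have -> : s * (x * D 1 x) = s * D 1 x * x by ring.
  by rewrite mulrA ler_pM2r// sD1// ltW.
have lb x : X < x / 2 -> s * (2 * (D 0 x - D 0 (x / 2))) <= s * (x * D 1 x).
  move=> Xx; have x0 : 0 < x / 2 := lt_trans X0 Xx.
  have [||c [xc cy ->]] := @mvt_upclosed _ _ _ _ (x / 2) x (@upclosed_pos R) d.
  - by rewrite pos_itv.
  - lra.
  have -> : x - x / 2 = x / 2 by lra.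
  have -> : s * (2 * (D 1 c * (x / 2))) = s * D 1 c * x by field.
  have -> : s * (x * D 1 x) = s * D 1 x * x by ring.
  rewrite ler_pM2r; last lra.
  by rewrite sD1// ?(lt_trans Xx)// ltW.
suff h : s * (x * D 1 x) @[x --> +oo] --> (0 : R).
  have -> : (fun x => x * D 1 x) = (fun x => s * (s * (x * D 1 x))).
    by apply/funext => x; rewrite mulrA; case: s1 => ->; ring.
  exact: cvg0M.
have y2 : 2 * x @[x --> +oo] --> (+oo : set_system R).
  by apply: gt0_cvgMry => //; exact: cvg_id.
have yh : x / 2 @[x --> +oo] --> (+oo : set_system R).
  by apply: gt0_cvgMly => //; exact: cvg_id.
have sq : \forall x \near +oo, s * (2 * (D 0 x - D 0 (x / 2))) <=
    s * (x * D 1 x) <= s * (D 0 (2 * x) - D 0 x).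
  near=> x; apply/andP; split.
    apply: lb; rewrite ltr_pdivlMr//.
    by near: x; apply: nbhs_pinfty_gt; exact: num_real.
  by apply: ub; near: x; apply: nbhs_pinfty_gt; exact: num_real.
apply: (squeeze_cvgr sq).
- by do 2 apply: cvg0M; apply: cvg0B => //; exact: cvg_comp D0.
- by apply: cvg0M; apply: cvg0B => //; exact: cvg_comp D0.
Unshelve. all: by end_near. Qed.

(** * Whale families and their exact sign counts *)

(* [D] is the sequence of derivatives of a whale-shaped function of order [m].
   Only upper bounds on sign changes are required: Rolle's theorem gives the
   exact counts. *)
Definition whale_family (R : realType) (m : nat) (D : nat -> R -> R) : Prop :=
  [/\ der_family `]0, +oo[ D,
      (forall x, 0 < x -> 0 <= D 0 x) /\ (exists2 x, 0 < x & D 0 x != 0),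
      D 0 x @[x --> +oo] --> (0 : R),
      forall n, (n < m)%N -> D n x @[x --> 0^'+] --> (0 : R) &
      forall n s, ~ alternates `]0, +oo[ (D n) m.+1 s].

Lemma whale_family_vanishes_right (R : realType) m (D : nat -> R -> R) n :
  whale_family m D -> vanishes_right `]0, +oo[ (D n).
Proof.
by move=> [dD _ D0 _ _]; apply: vanishes_right_family => //; exact: upclosed_pos.
Qed.

(** Starting from one positive value of [D 0], each differentiation gains a sign change while both
    ends vanish, that is up to order [m]; afterwards the right end alone preserves the count. *)
Lemma whale_family_lower (R : realType) m (D : nat -> R -> R) n :
  whale_family m D -> exists s, alternates `]0, +oo[ (D n) (minn n m) s.
Proof.
move=> W; have [dD [D0 [x x0 Dx]] _ vD _] := W.
have vr k := whale_family_vanishes_right k W.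
elim: n => [|n [s IH]].
  exists 1, (fun=> x); rewrite min0n; split => // -[|//] _.
    by rewrite pos_itv.
  by rewrite expr0 !mul1r lt_neqAle eq_sym Dx D0.
have [nm|mn] := ltnP n m.
  exists s; rewrite (minn_idPl nm); rewrite (minn_idPl (ltnW nm)) in IH.
  apply: rolle_alternates_both IH; [exact: upclosed_pos|exact: dD| |by []].
  exact/cvg0_vanishes_left_pos/vD.
exists (- s); rewrite (minn_idPr (leqW mn)); rewrite (minn_idPr mn) in IH.
by apply: rolle_alternates_right IH; [exact: upclosed_pos|exact: dD|by []].
Qed.

Lemma alternates_lift (R : realType) (D : nat -> R -> R) m n j N s :
  der_family `]0, +oo[ D -> D 0 x @[x --> +oo] --> (0 : R) ->
  (forall n, (n < m)%N -> D n x @[x --> 0^'+] --> (0 : R)) ->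
  (n + j <= m)%N ->
  alternates `]0, +oo[ (D n) N s -> alternates `]0, +oo[ (D (n + j)%N) (N + j) s.
Proof.
move=> dD D0 vD + alt; elim: j => [|j IH jm]; first by rewrite !addn0.
rewrite !addnS; rewrite addnS in jm; have {}IH := IH (ltnW jm).
apply: rolle_alternates_both IH; [exact: upclosed_pos|exact: dD| |].
- exact/cvg0_vanishes_left_pos/vD.
- by apply: vanishes_right_family => //; exact: upclosed_pos.
Qed.

(** For [n < m], a sign change too many in [D n] would be lifted to one too many in [D m]. *)
Lemma whale_family_upper (R : realType) m (D : nat -> R -> R) n s :
  whale_family m D -> ~ alternates `]0, +oo[ (D n) (minn n m).+1 s.
Proof.
move=> [dD _ D0 vD nalt]; have [nm|/ltnW mn] := leqP n m; last exact: nalt.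
move=> alt.
have nm' : (n + (m - n) <= m)%N by rewrite subnKC.
have := alternates_lift dD D0 vD nm' alt.
by rewrite addSn subnKC//; exact: nalt.
Qed.

Lemma whale_family_changes_sign (R : realType) m (D : nat -> R -> R) n :
  whale_family m D -> changes_sign `]0, +oo[ (D n) (minn n m).
Proof.
move=> W; split=> [|M]; first by have [s /alternates_sign] := whale_family_lower n W.
rewrite leqNgt => alt; apply/negP => Mn.
have [s] := sign_alternates_alternates (sign_alternates_le Mn alt).
exact: whale_family_upper.
Qed.

Lemma smooth_on_der_family (R : realType) (I : set R) (f : R -> R) :
  smooth_on I f -> der_family I (fun n => derive1n n f).
Proof. by move=> sf n x Ix; rewrite derive1nS derive1E; exact/derivableP/sf. Qed.

Lemma der_family_derive1n (R : realType) (I : set R) (f : R -> R) D :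
  open I -> der_family I D -> (forall x, I x -> f x = D 0 x) ->
  forall n x, I x -> derive1n n f x = D n x.
Proof.
move=> oI dD fD; elim=> [//|n IH x Ix].
rewrite derive1nS derive1E; have := dD n x Ix => dDn.
rewrite -(@derive_val _ _ _ _ _ _ _ dDn); apply: near_eq_derive.
by near=> y; apply: IH; near: y; exact: open_nbhs_nbhs.
Unshelve. all: by end_near. Qed.

Lemma der_family_smooth_on (R : realType) (I : set R) (f : R -> R) D :
  open I -> der_family I D -> (forall x, I x -> f x = D 0 x) -> smooth_on I f.
Proof.
move=> oI dD fD n x Ix; have := dD n x Ix => -[dDn _].
apply: near_eq_derivable dDn.
near=> y; rewrite (der_family_derive1n oI dD fD)//; near: y.
exact: open_nbhs_nbhs.
Unshelve. all: by end_near. Qed.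

Lemma eq_alternates (R : realType) (I : set R) (u v : R -> R) N s :
  (forall x, I x -> u x = v x) -> alternates I u N s -> alternates I v N s.
Proof.
move=> uv [x [Ix ltx sx]]; exists x; split => // j jN.
by rewrite -uv; [exact: sx|exact: Ix].
Qed.

Lemma whale_shaped_family (R : realType) m (f : R -> R) :
  whale_shaped m f -> whale_family m (fun n => derive1n n f).
Proof.
move=> [f0 sf finf fl cs]; split; [|split|exact: finf|exact: fl|].
- exact: smooth_on_der_family.
- by move=> x x0; exact/ltW/f0.
- by exists 1 => //; rewrite gt_eqF// f0.
- move=> n s /alternates_sign/((cs n).2 _); rewrite leqNgt ltnS.
  by rewrite geq_minr.
Qed.

Lemma open_pos (R : realType) : open (`]0, +oo[%classic : set R).
Proof. exact: interval_open. Qed.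

Lemma eq_changes_sign (R : realType) (I : set R) (u v : R -> R) N :
  (forall x, I x -> u x = v x) -> changes_sign I u N -> changes_sign I v N.
Proof.
move=> uv; have alt M w w' : (forall x, I x -> w x = w' x) ->
    sign_alternates I w M -> sign_alternates I w' M.
  move=> ww' [x [Ix ltx sx]]; exists x; split => // j jM.
  by rewrite -!ww'; [exact: sx|exact/Ix|exact/Ix/ltnW].
move=> [uN uM]; split; first exact: alt uv uN.
by move=> M vM; apply/uM/(alt _ _ _ _ vM) => x Ix; rewrite uv.
Qed.

Lemma whale_family_shaped (R : realType) m (D : nat -> R -> R) (f : R -> R) :
  whale_family m D -> (forall x, 0 < x -> 0 < D 0 x) ->
  (forall x, 0 < x -> f x = D 0 x) -> whale_shaped m f.
Proof.
move=> W D0 fD.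
have fD' x : `]0, +oo[%classic x -> f x = D 0 x by rewrite pos_itv; exact: fD.
have [dD _ Dinf vD _] := W.
have dE := der_family_derive1n (@open_pos R) dD fD'.
split.
- by move=> x x0; rewrite fD// D0.
- exact: der_family_smooth_on (@open_pos R) dD fD'.
- apply: cvg_trans Dinf; apply: near_eq_cvg; near=> x; apply/esym/fD.
  by near: x; apply: nbhs_pinfty_gt; exact: num_real.
- move=> n nm; apply: cvg_trans (vD n nm); apply: near_eq_cvg; near=> x.
  apply/esym/dE; rewrite pos_itv; near: x; exact: nbhs_right_gt.
- move=> n; apply: eq_changes_sign (whale_family_changes_sign n W) => x x0.
  by rewrite dE.
Unshelve. all: by end_near. Qed.

(** * The differential equation of an exponential factor *)

Lemma is_derive_expR_mul (R : realType) (a x d : R) (h : R -> R) :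
  is_derive x 1 h d ->
  is_derive x 1 (fun y => expR (a * y) * h y) (expR (a * x) * (a * h x + d)).
Proof.
move=> dh.
have d1 : is_derive x 1 (fun y : R => a * y) a.
  have := @is_deriveZ _ _ _ id a x 1 1 (is_derive_id _ _).
  by move=> h1; apply: is_derive_eq h1 _; rewrite /GRing.scale/= mulr1.
have d2 := @is_derive1_comp _ expR (fun y : R => a * y) x _ _ (is_derive_expR _) d1.
have := is_deriveM d2 dh => h1.
by apply: is_derive_eq h1 _; rewrite /GRing.scale/=; ring.
Qed.

(* The variation-diminishing property of [exp_factor a]: by Rolle, since
   [expR (x / a) * E n x] has derivative [expR (x / a) * D n x / a]. *)
Lemma whale_family_ode (R : realType) m (D : nat -> R -> R) (a : R) (h : R -> R) :
  0 < a -> whale_family m D ->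
  (forall x : R, 0 < x -> is_derive x 1 h ((D 0 x - h x) / a)) ->
  h x @[x --> 0^'+] --> (0 : R) ->
  exists E : nat -> R -> R, [/\ whale_family m.+1 E, E 0 = h &
    (forall x, 0 < x -> 0 < D 0 x) -> forall x, 0 < x -> 0 < h x].
Proof.
move=> a0 W dh h0; have [dD [D0 [x1 x10 Dx1]] Dinf vD nalt] := W.
(* The equation [h + a h' = D 0], differentiated repeatedly and solved for the highest
   derivative. *)
pose E := fix E n (x : R) := if n is n'.+1 then (D n' x - E n' x) / a else h x.
have dE : der_family `]0, +oo[ E.
  elim=> [|n IH] x; first by rewrite pos_itv; exact: dh.
  move=> Ix; have := IH x Ix; have := dD n x Ix => h1 h2.
  have := is_deriveM (is_deriveB h1 h2) (is_derive_cst a^-1 x 1) => h3.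
  apply: is_derive_eq h3 _; rewrite /GRing.scale/=; ring.
have an0 : a != 0 by rewrite gt_eqF.
have dH n (x : R) : `]0, +oo[%classic x ->
    is_derive x 1 (fun y => expR (a^-1 * y) * E n y) (expR (a^-1 * x) * (D n x / a)).
  move=> Ix; have := is_derive_expR_mul a^-1 (dE n x Ix) => h1.
  by apply: is_derive_eq h1 _ => /=; congr (_ * _); field.
have mvtH x y : 0 < x -> x < y -> exists c, [/\ x < c,
    0 < c & expR (a^-1 * y) * h y - expR (a^-1 * x) * h x =
    expR (a^-1 * c) * (D 0 c / a) * (y - x)].
  move=> x0 xy.
  have [|c [xc cy Ec]] := mvt_upclosed (@upclosed_pos R) (dH 0%N) _ xy.
    by rewrite pos_itv.
  by exists c; split => //; exact: lt_trans xc.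
(* Since [h] vanishes at 0, a negative value at [x] is preceded by some [y < x] with [h x < h y];
   this contradicts the monotonicity of [expR (x / a) * h x]. *)
have hge0 x : 0 < x -> 0 <= h x.
  move=> x0; rewrite leNgt; apply/negP => hx.
  have [||y] := cvg0_vanishes_left_pos h0 (x := x) (e := - h x).
  - by rewrite pos_itv.
  - by rewrite oppr_gt0.
  rewrite pos_itv => -[y0 yx hy].
  have [c [_ c0 Ec]] := mvtH _ _ y0 yx.
  have : 0 <= expR (a^-1 * x) * h x - expR (a^-1 * y) * h y.
    rewrite Ec !mulr_ge0 ?expR_ge0 ?invr_ge0 ?D0 ?subr_ge0 ?(ltW c0) ?(ltW a0)//.
    exact: ltW.
  rewrite subr_ge0 leNgt => /negP; apply.
  have hy' : h x < h y by move: hy; rewrite ltr_norml opprK => /andP[].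
  have [hy0|hy0] := leP 0 (h y).
    by apply: lt_le_trans (_ : 0 <= _); rewrite ?pmulr_rlt0 ?mulr_ge0 ?expR_ge0 ?expR_gt0.
  apply: (@lt_le_trans _ _ (expR (a^-1 * x) * h y)); first by rewrite ltr_pM2l ?expR_gt0.
  by rewrite ler_nM2r// ler_expR ler_pM2l ?invr_gt0// ltW.
have hinf : h x @[x --> +oo] --> (0 : R).
  apply/cvgr0Pnorm_lt => e e0.
  have e2 : 0 < e / 2 by rewrite divr_gt0.
  move/cvgr0_norm_lt: Dinf => /(_ _ e2)[M [_ MD]].
  pose X := Num.max M 1; have X0 : 0 < X by rewrite lt_max ltr01 orbT.
  (* Beyond [X] the source [D 0] is below [e / 2], so [K] does not increase there, and [h x - e / 2]
     is at most [K X * expR (- x / a)]. *)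
  pose K (y : R) := expR (a^-1 * y) * (h y - e / 2).
  have dK (x : R) : `]0, +oo[%classic x ->
      is_derive x 1 K (expR (a^-1 * x) * ((D 0 x - e / 2) / a)).
    rewrite pos_itv => x0; have := dh x x0 => h1.
    have := is_derive_expR_mul a^-1 (is_deriveB h1 (is_derive_cst (e / 2) x 1)).
    by move=> h2; apply: is_derive_eq h2 _; congr (_ * _); rewrite !fctE; field.
  have KX x : X < x -> K x <= K X.
    move=> Xx; have [|c [Xc cx E']] := mvt_upclosed (@upclosed_pos R) dK _ Xx.
      by rewrite pos_itv.
    rewrite -subr_le0 E' mulr_le0_ge0 ?subr_ge0 ?(ltW Xx)//.
    rewrite mulr_ge0_le0 ?expR_ge0// mulr_le0_ge0 ?invr_ge0 ?(ltW a0)//.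
    rewrite subr_le0 ltW//; apply: le_lt_trans (ler_norm _) (MD _ _).
    by apply: le_lt_trans Xc; rewrite le_max lexx.
  have : K X * expR (- (a^-1 * x)) @[x --> +oo] --> (0 : R).
    apply: cvg0M; apply: (@cvg_comp _ _ _ (fun x => a^-1 * x) (fun y => expR (- y))) (@cvgr_expR R).
    by apply: gt0_cvgMry; rewrite ?invr_gt0//; exact: cvg_id.
  move=> /cvgr0_norm_lt/(_ _ e2) KX0.
  near=> x.
  have Xx : X < x by near: x; apply: nbhs_pinfty_gt; exact: num_real.
  rewrite ger0_norm ?hge0 ?(lt_trans X0)//.
  have : `|K X * expR (- (a^-1 * x))| < e / 2 by near: x.
  move=> /(le_lt_trans (ler_norm _)).
  have := KX x Xx; rewrite {1}/K mulrC -ler_pdivlMr ?expR_gt0// -expRN.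
  lra.
exists E; split => //; last first.
  move=> D0p x x0.
  have x20 : 0 < x / 2 by rewrite divr_gt0.
  have x2x : x / 2 < x by lra.
  have [c [_ c0 Ec]] := mvtH _ _ x20 x2x.
  rewrite -(pmulr_rgt0 _ (expR_gt0 (a^-1 * x))).
  apply: (@le_lt_trans _ _ (expR (a^-1 * (x / 2)) * h (x / 2))).
    by rewrite mulr_ge0 ?expR_ge0 ?hge0.
  rewrite -subr_gt0 Ec !mulr_gt0 ?expR_gt0 ?D0p ?invr_gt0//.
  by rewrite subr_gt0.
split.
- exact: dE.
- split => //; apply: contrapT => hn.
  (* If [h] vanished identically, so would [D 0 = h + a h'], against [D 0 x1 != 0]. *)
  have hz x : 0 < x -> h x = 0.
    by move=> x0; apply/eqP; apply: contrapT => /negP hx; apply: hn; exists x.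
  have := dh _ x10 => h1.
  have /esym : 'D_1 h x1 = 'D_1 (cst 0 : R -> R) x1.
    apply: near_eq_derive; near=> y; apply: hz.
    by near: y; exact: lt_nbhsr.
  rewrite derive_val (@derive_val _ _ _ _ _ _ _ h1) hz// subr0 => /esym/eqP.
  by rewrite mulf_eq0 invr_eq0 (negbTE Dx1) (negbTE an0).
- exact: hinf.
- elim=> [_|n IH nm]; first exact: h0.
  rewrite /=; under eq_fun do rewrite mulrC.
  apply: cvg0M; apply: cvg0B; [exact: vD|exact/IH/ltnW].
- move=> n s alt; apply: (nalt n (- s)).
  have := (alternates_mulpos (w := fun x => expR (a^-1 * x)) (u := E n)
    (v := fun x => expR (a^-1 * x) * E n x) m.+2 s _ (fun _ _ => erefl)).2.
  move=> /(_ `]0, +oo[%classic (fun _ _ => expR_gt0 _) alt).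
  move=> /(rolle_alternates (@upclosed_pos R) (dH n)).
  apply: (alternates_mulpos (w := fun x => expR (a^-1 * x) / a) _ _ _ _).1 => x _.
    by rewrite divr_gt0 ?expR_gt0.
  by rewrite mulrA mulrAC.
Unshelve. all: by end_near. Qed.

(** * Removing one sign change *)

Lemma same_sign_trans (R : realType) (a b c d : R) :
  0 < a * b -> 0 < c * b -> 0 < c * d -> 0 < a * d.
Proof.
move=> ab cb cd; have := mulr_gt0 (mulr_gt0 ab cb) cd.
have -> : a * b * (c * b) * (c * d) = a * d * (c * b) ^+ 2 by ring.
by rewrite pmulr_lgt0// exprn_even_gt0//= gt_eqF.
Qed.

(** The points stay explicit instead of being hidden in [alternates], so that extensions can be
    chained. *)
Lemma alternates_rcons (R : realType) (I : set R) (u : R -> R) N s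
    (x : nat -> R) y :
  [/\ forall j : nat, (j <= N)%N -> I (x j),
      forall j : nat, (j < N)%N -> x j < x j.+1 &
      forall j : nat, (j <= N)%N -> 0 < s * (-1) ^+ j * u (x j)] ->
  I y -> x N < y -> 0 < s * (-1) ^+ N.+1 * u y ->
  let x' := fun j => if (j <= N)%N then x j else y in
  [/\ forall j : nat, (j <= N.+1)%N -> I (x' j),
      forall j : nat, (j < N.+1)%N -> x' j < x' j.+1 &
      forall j : nat, (j <= N.+1)%N -> 0 < s * (-1) ^+ j * u (x' j)].
Proof.
move=> [Ix ltx sx] Iy xy sy x'; rewrite /x'; split => j jN.
- by case: ifP => // /Ix.
- rewrite ltnS in jN; rewrite jN; case: ifP => [|/negbT]; first exact: ltx.
  by rewrite -leqNgt => Nj; have -> : j = N by apply/eqP; rewrite eqn_leq jN.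
- case: ifP => [|/negbT]; first exact: sx.
  by rewrite -ltnNge => Nj; have -> : j = N.+1 by apply/eqP; rewrite eqn_leq jN.
Qed.

(** The point [c] is where [u] takes its final sign for good: it is the infimum of the points right
    of [x m] where [u] has the sign of [u (x m.+1)]. Multiplication by [c - x] merges the last two
    sign blocks. Were [m.+1] sign changes left, appending [x m], [x m.+1] or a point of [A] to the
    points left of [c] would give [m.+2] sign changes of [u]. *)
Lemma remove_sign_change (R : realType) (u : R -> R) m s :
  alternates `]0, +oo[ u m.+1 s ->
  (forall s', ~ alternates `]0, +oo[ u m.+2 s') ->
  exists2 c : R, 0 < c &
    forall s', ~ alternates `]0, +oo[ (fun x => (c - x) * u x) m.+1 s'.
Proof.
(* [t] carries the sign of [u] at [x m.+1]; at [x m] the sign is opposite. *)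
move=> [x [Ix ltx sx]] nalt; pose t : R := s * (-1) ^+ m.+1.
pose A : set R := [set y | x m <= y /\ 0 < t * u y].
have tx : 0 < t * u (x m.+1) by exact: sx.
have ntx : 0 < - t * u (x m).
  by have := sx m (leqnSn _); rewrite /t exprS mulN1r mulrN opprK.
have A0 : A !=set0 by exists (x m.+1); split => //; exact/ltW/ltx.
have lbA : has_lbound A by exists (x m) => y [].
have infA : has_inf A by [].
have Apos y : A y -> x m < y.
  move=> [xy ty]; rewrite lt_neqAle xy andbT; apply/eqP => E.
  by move: ntx; rewrite E mulNr oppr_gt0 ltNge (ltW ty).
pose c := inf A.
have xmc : x m <= c by apply: lb_le_inf => // y [].
have c0 : 0 < c by apply: lt_le_trans xmc; rewrite -pos_itv; exact: Ix.
have fact1 y : y < c -> 0 < t * u y -> y < x m.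
  move=> yc ty; rewrite ltNge; apply/negP => xy.
  have : c <= y by apply: (ge_inf lbA).
  by rewrite leNgt yc.
(* Otherwise [x 0], ..., [x m], a point of [A] below [y], and [y] itself would show [m.+2] sign
   changes. *)
have fact2 y : c < y -> 0 <= t * u y.
  move=> cy; rewrite leNgt; apply/negP => ty.
  have [z Az zy] := inf_lt A0 cy; have [xz tz] := Az.
  have base : [/\ forall j : nat, (j <= m)%N -> `]0, +oo[%classic (x j),
      forall j : nat, (j < m)%N -> x j < x j.+1 &
      forall j : nat, (j <= m)%N -> 0 < s * (-1) ^+ j * u (x j)].
    by split => j jm; [exact/Ix/leqW|exact/ltx/leqW|exact/sx/leqW].
  have Iz : `]0, +oo[%classic z.
    by rewrite pos_itv; apply: lt_le_trans xz; rewrite -pos_itv; exact: Ix.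
  have b1 := alternates_rcons base Iz (Apos _ Az) tz.
  have b2 := alternates_rcons b1 (upclosed_pos Iz (ltW zy)).
  apply: (nalt s); eexists; apply: b2; first by rewrite ltnn.
  by rewrite exprS mulN1r mulrN -/t mulNr oppr_gt0.
have factA y : c < y -> (c - y) * (t * u y) <= 0.
  by move=> cy; rewrite mulr_le0_ge0 ?fact2// subr_le0 ltW.
exists c => // s' [y [Iy lty sy]].
have lty' i j : (i <= j)%N -> (j <= m.+1)%N -> y i <= y j.
  elim: j => [|j IH]; first by rewrite leqn0 => /eqP->.
  rewrite leq_eqVlt => /predU1P[->//|ij] jm.
  exact: le_trans (IH ij (ltnW jm)) (ltW (lty _ jm)).
have yc j : (j <= m.+1)%N -> y j < c -> 0 < s' * (-1) ^+ j * u (y j).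
  move=> jm yjc; have := sy _ jm.
  by rewrite mulrCA pmulr_rgt0// subr_gt0.
have below N : (N <= m.+1)%N -> y N < c ->
    [/\ forall j : nat, (j <= N)%N -> `]0, +oo[%classic (y j),
      forall j : nat, (j < N)%N -> y j < y j.+1 &
      forall j : nat, (j <= N)%N -> 0 < s' * (-1) ^+ j * u (y j)].
  move=> Nm yNc; split => j jN.
  - exact/Iy/(leq_trans jN).
  - exact/lty/(leq_trans jN).
  - apply: yc; first exact: leq_trans Nm.
    exact: le_lt_trans (lty' _ _ jN Nm) yNc.
have Ixm : `]0, +oo[%classic (x m) by exact: Ix.
(* All points lie left of [c], so [u] alternates along them. If the last value has sign [t], the
   point lies left of [x m], which is appended; otherwise a point of [A] is. *)
have [yk|yk] := ltP (y m.+1) c.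
  have b1 := below _ (leqnn _) yk.
  have s1 := yc _ (leqnn _) yk.
  have [tu|tu] := ltP 0 (t * u (y m.+1)).
    have yx := fact1 _ yk tu.
    apply: (nalt s'); eexists; apply: alternates_rcons b1 Ixm yx _.
    rewrite exprS mulN1r mulrN mulNr -mulrN.
    by apply: same_sign_trans s1 tu _; rewrite mulrN -mulNr.
  have [z Az zy] : exists2 z, A z & y m.+1 < z.
    exists (x m.+1); first by split => //; exact/ltW/ltx.
    apply: lt_le_trans yk _; apply: ge_inf => //.
    by split => //; exact/ltW/ltx.
  have Iz : `]0, +oo[%classic z.
    by rewrite pos_itv; apply: lt_trans (Apos _ Az); rewrite -pos_itv.
  apply: (nalt s'); eexists; apply: alternates_rcons b1 Iz zy _.
  rewrite exprS mulN1r mulrN mulNr -mulrN.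
  apply: (same_sign_trans s1 (c := - t)); last by rewrite mulrNN Az.2.
  rewrite mulNr oppr_gt0 lt_neqAle tu andbT mulf_eq0 !negb_or.
  apply/andP; split; first by apply: contraTneq tx => ->; rewrite mul0r ltxx.
  by apply: contraTneq s1 => ->; rewrite mulr0 ltxx.
have t0 : t != 0 by apply: contraTneq tx => ->; rewrite mul0r ltxx.
have beyond j : (j <= m.+1)%N -> c <= y j ->
    0 < - t * ((c - y j) * u (y j)).
  move=> jm cyj; have := sy _ jm => sj.
  have cyj0 : (c - y j) * u (y j) != 0.
    by apply: contraTneq sj => ->; rewrite mulr0 ltxx.
  rewrite mulNr oppr_gt0 lt_neqAle mulf_eq0 negb_or t0 cyj0/= mulrCA.
  apply: factA; rewrite lt_neqAle cyj andbT; apply: contraNneq cyj0 => ->.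
  by rewrite subrr mul0r.
have sV := beyond _ (leqnn _) yk.
have pV := sy _ (leqnn m.+1).
set p := s' * (-1) ^+ m.+1 in pV.
have pE : s' * (-1) ^+ m = - p by rewrite /p exprS; ring.
(* Beyond [c] the product can only have the sign of [- t], so the last two points cannot both lie
   there; then [x m] and [x m.+1] are appended after [y m]. *)
have [ym|ym] := leP c (y m).
  have := beyond _ (leqnSn m) ym; have := sy _ (leqnSn m); rewrite pE => h1 h2.
  have := same_sign_trans h1 h2 sV; rewrite mulNr oppr_gt0 => h3.
  by have := lt_trans h3 pV; rewrite ltxx.
have sm := yc _ (leqnSn m) ym; rewrite pE in sm.
have yx : y m < x m.
  apply: fact1 => //; apply: (same_sign_trans _ _ sm (b := - ((c - y m.+1) * u (y m.+1)))).
    by rewrite mulrN -mulNr.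
  by rewrite mulrNN.
have b1 := below _ (leqnSn m) ym.
have pxm : 0 < p * u (x m) by exact: same_sign_trans pV sV ntx.
have b2 := alternates_rcons b1 Ixm yx pxm.
have Ixm1 : `]0, +oo[%classic (x m.+1) by exact: Ix.
have b3 := alternates_rcons b2 Ixm1.
apply: (nalt s'); eexists; apply: b3; first by rewrite ltnn; exact: ltx.
rewrite exprS mulN1r mulrN mulNr -mulrN.
by apply: same_sign_trans pV sV _; rewrite mulrNN.
Qed.

(** Finitely many strict inequalities survive a small pointwise perturbation. *)
Lemma alternates_cvg (R : realType) (T : Type) (F : set_system T)
    {FF : Filter F} (I : set R) (u_ : T -> R -> R) (u : R -> R) N s :
  (forall x, I x -> u_ t x @[t --> F] --> u x) ->
  alternates I u N s -> \forall t \near F, alternates I (u_ t) N s.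
Proof.
move=> uu [x [Ix ltx sx]].
have : \forall t \near F, forall j : 'I_N.+1, 0 < s * (-1) ^+ j * u_ t (x j).
  apply: filter_forall => j.
  have jN : (j <= N)%N by rewrite -ltnS.
  have h : s * (-1) ^+ j * u_ t (x j) @[t --> F] --> s * (-1) ^+ j * u (x j).
    by apply: cvgMl_tmp; exact/uu/Ix.
  exact: (cvgr_gt _ h _ (sx j jN)).
apply: filterS => t ht; exists x; split => // j jN.
by have := ht (Ordinal (jN : (j < N.+1)%N)).
Qed.

Lemma unit_itv_cluster (R : realType) (t : nat -> R) :
  (forall n, t n \in `[0, 1]) ->
  exists l : R, l \in `[0, 1] /\
    exists k : nat -> nat, (forall i, (i <= k i)%N) /\ t (k i) @[i --> \oo] --> l.
Proof.
move=> t01.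
have [|l [l01 cl]] := @segment_compact R 0 1 (t @ \oo) _.
  by exists 0%N => // n _; exact: t01.
exists l; split => //.
have /choice[k kP] : forall i, exists k, (i <= k)%N /\ `|l - t k| < i.+1%:R^-1.
  move=> i; have i0 : 0 < i.+1%:R^-1 :> R by rewrite invr_gt0.
  have [||y [[k ik yk] ly]] := cl [set t k | k in [set k | (i <= k)%N]] (ball l i.+1%:R^-1).
  - by exists i => // k /= ik; exists k.
  - exact: nbhsx_ballx.
  by exists k; split => //; rewrite yk.
exists k; split=> [i|]; first by have [] := kP i.
apply/cvgrPdist_lt => e e0; near=> i.
have [_ h] := kP i; apply: lt_trans h _.
by near: i; exact: near_infty_natSinv_lt (PosNum e0).
Unshelve. all: by end_near. Qed.

Lemma two_signs_alternates (R : realType) (I : set R) (u : R -> R) (x y : R) :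
  I x -> I y -> 0 < u x -> u y < 0 -> exists s, alternates I u 1 s.
Proof.
wlog xy : u x y / x < y => [hw Ix Iy ux uy|Ix Iy ux uy].
  have [xy|yx|E] := ltgtP x y; first exact: hw xy Ix Iy ux uy.
    have [||s /alternates_opp alt] := hw (fun z => - u z) y x yx Iy Ix.
    - by rewrite oppr_gt0.
    - by rewrite oppr_lt0.
    by exists (- s); apply: eq_alternates alt => z _; rewrite opprK.
  by move: uy; rewrite -E ltNge ltW.
exists 1, (fun j => if j is 0%N then x else y); split.
- by case.
- by case.
- case=> [_|[_|//]]; first by rewrite expr0 !mul1r.
  by rewrite expr1 mul1r mulN1r oppr_gt0.
Qed.

Lemma is_derive_mul_affine (R : realType) (u v : R -> R) (b c x du dv : R) :
  is_derive x 1 u du -> is_derive x 1 v dv ->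
  is_derive x 1 (fun y => b * u y + (c - y) * v y)
    (b * du + ((c - x) * dv - v x)).
Proof.
move=> hu hv.
have h1 := is_deriveB (is_derive_cst c x 1) (is_derive_id x (1 : R)).
have h2 := is_deriveM h1 hv.
have h3 := is_deriveD (is_deriveM (is_derive_cst b x 1) hu) h2.
by apply: is_derive_eq h3 _; rewrite /GRing.scale/= !fctE; ring.
Qed.

Lemma whale_family_cvg_derive (R : realType) m (D : nat -> R -> R) :
  whale_family m D -> D 1 x @[x --> +oo] --> (0 : R).
Proof.
move=> [dD _ Dinf _ nalt].
have := cvg_mul_derive_pinfty dD Dinf (nalt 2).
move=> /cvgr0Pnorm_lt xD1; apply/cvgr0Pnorm_lt => e /xD1 {}xD1.
near=> x; apply: (@le_lt_trans _ _ `|x * D 1 x|); last by near: x.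
rewrite normrM ler_peMl//; apply: le_trans (ler_norm _).
by near: x; apply: nbhs_pinfty_ge; exact: num_real.
Unshelve. all: by end_near. Qed.

(* With [c] a sign change of [D p.+1], the function
   [p * D 0 x + (c - x) * D 1 x] has [p]-th derivative [(c - x) * D p.+1 x]:
   one sign change is removed. *)
Lemma whale_family_remove_sign_change (R : realType) m (D : nat -> R -> R) p :
  whale_family m.+1 D -> (m <= p)%N ->
  exists2 c : R, 0 < c & forall k s, (k <= p)%N ->
    ~ alternates `]0, +oo[
      (fun x => (p%:R - k%:R) * D k x + (c - x) * D k.+1 x) m.+1 s.
Proof.
move=> W mp; have [dD _ Dinf _ nalt] := W.
have [s] := whale_family_lower p.+1 W.
rewrite (minn_idPr (mp : (m < p.+1)%N)).
move=> /remove_sign_change/(_ (nalt p.+1))[c c0 nc]; exists c => // k {}s kp alt.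
(* Each differentiation of [c - x] contributes [- D k.+1], so the first coefficient drops by one and
   vanishes at [k = p]. *)
pose V k x := (p%:R - k%:R) * D k x + (c - x) * D k.+1 x.
have dV : der_family `]0, +oo[ V.
  move=> n x Ix; have h1 := is_derive_mul_affine (p%:R - n%:R) c (dD n x Ix) (dD n.+1 x Ix).
  by apply: is_derive_eq h1 _; rewrite /V -(natr1 n); ring.
have xD1 := cvg_mul_derive_pinfty dD Dinf (nalt 2).
have D1 := whale_family_cvg_derive W.
have Vinf : V 0 x @[x --> +oo] --> (0 : R).
  have -> : V 0 = fun x => p%:R * D 0 x + (c * D 1 x - x * D 1 x).
    by apply/funext => x; rewrite /V; ring.
  by apply: cvg0D; [exact: cvg0M|apply: cvg0B => //; exact: cvg0M].
(* The right end alone preserves the count from order [k] up to order [p], where only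
   [(c - x) * D p.+1 x] remains. *)
have {alt} [s' alt] : exists s', alternates `]0, +oo[ (V (k + (p - k))%N) m.+1 s'.
  elim: (p - k)%N => [|j [s' IH]]; first by exists s; rewrite addn0.
  exists (- s'); rewrite addnS; apply: rolle_alternates_right IH.
  - exact: upclosed_pos.
  - exact: dV.
  - by apply: vanishes_right_family => //; exact: upclosed_pos.
apply: (nc s'); rewrite subnKC// in alt.
by apply: eq_alternates alt => x _; rewrite /V subrr mul0r add0r.
Qed.

Lemma whale_family_factor (R : realType) m (D : nat -> R -> R) :
  whale_family m.+1 D ->
  exists2 a : R, 0 < a & whale_family m (fun n x => D n x + a * D n.+1 x).
Proof.
move=> W; have [dD [D0 [x1 x10 Dx1]] Dinf vD nalt] := W.
have mp p : (m <= p.+1 + m)%N by rewrite leq_addl.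
have /choice[c cP] : forall p, exists c : R, 0 < c /\ forall k s, (k <= p.+1 + m)%N ->
    ~ alternates `]0, +oo[
      (fun x => ((p.+1 + m)%:R - k%:R) * D k x + (c - x) * D k.+1 x) m.+1 s.
  by move=> p; have [c] := whale_family_remove_sign_change W (mp p); exists c.
(* Division by [q p] turns the weights [p.+1 + m] and [c p] into [1 - t p] and [t p]; also
   [q p > p], whatever [c p] is. *)
pose q p : R := (p.+1 + m)%:R + c p.
have q0 p : 0 < q p by rewrite /q addr_gt0 ?(cP p).1.
pose t p := c p / q p.
have t01 p : t p \in `[0, 1].
  rewrite in_itv/= divr_ge0 ?(ltW (cP p).1) ?(ltW (q0 p))//=.
  by rewrite ler_pdivrMr// mul1r /q lerDr.
have [l [l01 [k [ik tk]]]] := unit_itv_cluster t01.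
have qinf : (q (k i))^-1 @[i --> \oo] --> (0 : R).
  apply: (@squeeze_cvgr _ _ _ _ (cst 0) (@harmonic R)); last 2 first.
  - exact: cvg_cst.
  - exact: cvg_harmonic.
  near=> i; rewrite invr_ge0 (ltW (q0 _))/= /harmonic/= lef_pV2 ?posrE ?q0//.
  rewrite /q -[leLHS]addr0 lerD ?(ltW (cP _).1)// ler_nat.
  by rewrite addSn ltnS (leq_trans (ik i))// leq_addr.
have lalt n s : ~ alternates `]0, +oo[ (fun x => (1 - l) * D n x + l * D n.+1 x) m.+1 s.
  move=> alt.
  (* For fixed [n] and [x] the subtracted term tends to zero with the inverse of [q], which leaves
     the convex combination. *)
  pose w i x := ((k i).+1 + m)%:R / q (k i) * D n x + t (k i) * D n.+1 x -
    (q (k i))^-1 * (n%:R * D n x + x * D n.+1 x).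
  have wE i x : w i x = (q (k i))^-1 * ((((k i).+1 + m)%:R - n%:R) * D n x +
      (c (k i) - x) * D n.+1 x).
    by rewrite /w /t; ring.
  have tE i : ((k i).+1 + m)%:R / q (k i) = 1 - t (k i).
    have qn := lt0r_neq0 (q0 (k i)).
    by apply: (mulIf qn); rewrite mulrBl mul1r !divfK// /q addrK.
  have wl x : `]0, +oo[%classic x ->
      w i x @[i --> \oo] --> (1 - l) * D n x + l * D n.+1 x.
    move=> _; rewrite -[X in _ --> X]subr0; apply: cvgB.
      under eq_fun do rewrite tE.
      apply: cvgD; apply: cvgMr_tmp => //.
      by apply: cvgB => //; exact: cvg_cst.
    by under eq_fun do rewrite mulrC; exact: cvg0M.
  have [i [ni walt]] : exists i, (n <= i)%N /\ alternates `]0, +oo[ (w i) m.+1 s.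
    near \oo => i; exists i; split; first by near: i; exact: nbhs_infty_ge.
    by near: i; exact: alternates_cvg wl alt.
  have nk : (n <= (k i).+1 + m)%N.
    by rewrite addSn -addnS (leq_trans ni)// (leq_trans (ik i))// leq_addr.
  apply: ((cP (k i)).2 n s nk).
  apply: (alternates_mulpos (w := fun=> (q (k i))^-1) _ _ _ _).1 walt => x _.
    by rewrite invr_gt0.
  exact: wE.
have [s lower] := whale_family_lower m.+1 W; rewrite minnn in lower.
(* Order [m.+1] with [l = 0] and order [m] with [l = 1] would both leave a multiple of [D m.+1],
   which has [m.+1] sign changes. *)
have l0 : l != 0.
  apply/eqP => l0; apply: (lalt m.+1 s); apply: eq_alternates lower => x _.
  by rewrite l0; ring.
have l1 : l != 1.
  apply/eqP => l1; apply: (lalt m s); apply: eq_alternates lower => x _.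
  by rewrite l1; ring.
have lgt0 : 0 < l by move: l01; rewrite in_itv/= lt_neqAle eq_sym l0 => /andP[].
have llt1 : 0 < 1 - l.
  by rewrite subr_gt0 lt_neqAle l1; move: l01; rewrite in_itv/= => /andP[].
pose a := l / (1 - l); have a0 : 0 < a by rewrite divr_gt0.
exists a => //; pose U n x := D n x + a * D n.+1 x.
have Ualt n s' : ~ alternates `]0, +oo[ (U n) m.+1 s'.
  move=> alt; apply: (lalt n s').
  apply: (alternates_mulpos (w := fun=> 1 - l) _ _ _ _).2 alt => x _ //.
  by rewrite /U /a; field; rewrite gt_eqF.
have dU : der_family `]0, +oo[ U.
  move=> n x Ix; have h1 := is_deriveD (dD n x Ix)
    (is_deriveM (is_derive_cst a x 1) (dD n.+1 x Ix)).
  by apply: is_derive_eq h1 _; rewrite /U/= /GRing.scale/=; ring.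
have Uinf : U 0 x @[x --> +oo] --> (0 : R).
  by apply: cvg0D => //; apply: cvg0M; exact: whale_family_cvg_derive W.
have vU n : (n < m)%N -> U n x @[x --> 0^'+] --> (0 : R).
  move=> nm; apply: cvg0D; first exact/vD/ltnW.
  by apply: cvg0M; exact: vD.
have Dx1_gt0 : 0 < D 0 x1 by rewrite lt_neqAle eq_sym Dx1 D0.
have dH (x : R) : `]0, +oo[%classic x ->
    is_derive x 1 (fun y => expR (a^-1 * y) * D 0 y) (expR (a^-1 * x) * (U 0 x / a)).
  move=> Ix; have h1 := is_derive_expR_mul a^-1 (dD 0%N x Ix).
  by apply: is_derive_eq h1 _; congr (_ * _); rewrite /U; field; rewrite gt_eqF.
(* [expR (x / a) * D 0 x] grows from a small value near 0 to its value at [x1], so its derivative is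
   positive somewhere in between. *)
have [z z0 Uz] : exists2 z, 0 < z & 0 < U 0 z.
  have Ix1 : `]0, +oo[%classic x1 by rewrite pos_itv.
  have [y [Iy yx Dy]] := cvg0_vanishes_left_pos (vD 0%N isT) Ix1 Dx1_gt0.
  have [z [yz _ E]] := mvt_upclosed (@upclosed_pos R) dH Iy yx.
  have z0 : 0 < z by apply: lt_trans yz; rewrite -pos_itv.
  exists z => //.
  have : 0 < expR (a^-1 * x1) * D 0 x1 - expR (a^-1 * y) * D 0 y.
    have y0 : 0 < y by rewrite -pos_itv.
    rewrite subr_gt0 ltr_pM ?expR_ge0 ?D0 ?(le_lt_trans (ler_norm _) Dy)//.
    by rewrite ltr_expR ltr_pM2l ?invr_gt0.
  rewrite E pmulr_lgt0 ?subr_gt0// pmulr_rgt0 ?expR_gt0//.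
  by rewrite pmulr_lgt0 ?invr_gt0.
split => //; split; last by exists z => //; rewrite gt_eqF.
(* A negative value of [U 0] besides the positive one at [z] would be lifted to [m.+1] sign changes
   of [U m]. *)
move=> x x0; rewrite leNgt; apply/negP => Ux.
have [||s' alt] := two_signs_alternates _ _ Uz Ux (I := `]0, +oo[%classic).
- by rewrite pos_itv.
- by rewrite pos_itv.
have m0 : (0 + m <= m)%N by rewrite add0n.
by apply: (Ualt m s'); have := alternates_lift dU Uinf vU m0 alt; rewrite add0n add1n.
Unshelve. all: by end_near. Qed.

(** * Order zero and complete monotonicity *)

Lemma whale_family0_completely_monotone (R : realType) (D : nat -> R -> R) :
  whale_family 0 D ->
  forall n x, 0 < x -> 0 <= (-1) ^+ n * D n x.
Proof.
move=> W; have [dD [D0 _] Dinf _ nalt] := W.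
elim=> [|n IH] x x0; first by rewrite expr0 mul1r D0.
(* If [D n] is nonzero somewhere, its decay forces a value of [D n.+1] of the opposite sign, and
   [D n.+1] does not change sign. Otherwise [D n], and with it [D n.+1], vanishes identically. *)
have [[y y0 Dy]|Dn0] := pselect (exists2 y, 0 < y & 0 < (-1) ^+ n * D n y).
  have alt : alternates `]0, +oo[ (D n) 0 ((-1) ^+ n).
    exists (fun=> y); split => // -[_|//]; first by rewrite pos_itv.
    by rewrite expr0 mulr1.
  have := rolle_alternates_right (@upclosed_pos R) (dD n)
    (whale_family_vanishes_right n W) alt.
  move=> [z [Iz _ /(_ 0%N isT)]]; rewrite expr0 mulr1 => Dz'.
  have Dz : 0 < (-1) ^+ n.+1 * D n.+1 (z 0%N) by rewrite exprS mulN1r.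
  rewrite leNgt; apply/negP => Dx.
  have [|s] := @two_signs_alternates _ `]0, +oo[%classic
    (fun x => (-1) ^+ n.+1 * D n.+1 x) _ x (Iz 0%N isT) _ Dz Dx.
    by rewrite pos_itv.
  move=> [w [Iw ltw sw]]; apply: (nalt n.+1 (s * (-1) ^+ n.+1)).
  exists w; split => // j j1; have := sw j j1; congr (_ < _); ring.
have Dn0' y : 0 < y -> D n y = 0.
  move=> y0; have : (-1) ^+ n * D n y = 0.
    apply/eqP; rewrite eq_le IH// andbT leNgt; apply/negP => h.
    by apply: Dn0; exists y.
  by move/eqP; rewrite mulf_eq0 signr_eq0 => /eqP.
have := dD n x; rewrite pos_itv => /(_ x0) h1.
rewrite -(@derive_val _ _ _ _ _ _ _ h1) (_ : 'D_1 (D n) x = 'D_1 (cst 0 : R -> R) x).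
  by rewrite derive_val mulr0.
by apply: near_eq_derive; near=> y; apply: Dn0'; near: y; exact: lt_nbhsr.
Unshelve. all: by end_near. Qed.

Lemma completely_monotone_fin_diff (R : realType) (D : nat -> R -> R) n d x :
  der_family `]0, +oo[ D -> (forall n x, 0 < x -> 0 <= (-1) ^+ n * D n x) ->
  0 < x -> 0 < d -> 0 <= (-1) ^+ n * fin_diff n d (D 0) x.
Proof.
move=> dD D0 x0 d0; have Ix : `]0, +oo[%classic x by rewrite pos_itv.
have [z [xz _ ->]] := fin_diff_mvt n (@upclosed_pos R) dD Ix d0.
by rewrite mulrCA mulr_ge0 ?exprn_ge0 ?(ltW d0)// D0// (lt_le_trans x0).
Qed.

(** Only the two sample points left of [c] contribute, with binomial coefficients 1 and [n]. *)
Lemma fin_diff_vanishing (R : realType) (u : R -> R) n c d :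
  0 < d -> (forall x, c <= x -> u x = 0) ->
  (-1) ^+ n * fin_diff n d u (c - d - d) = u (c - d - d) - n%:R * u (c - d).
Proof.
move=> d0 u0.
have f0 k x : c <= x -> fin_diff k d u x = 0.
  elim: k x => [|k IH] x cx /=; first exact: u0.
  by rewrite !IH ?subrr// (le_trans cx)// lerDl ltW.
have f1 k : (-1) ^+ k * fin_diff k d u (c - d) = u (c - d).
  elim: k => [|k IH] /=; first by rewrite expr0 mul1r.
  by rewrite exprS subrK f0// sub0r mulrN mulN1r mulNr opprK.
elim: n => [|n IH]; first by rewrite expr0 mul1r mul0r subr0.
rewrite /= subrK exprS mulrBr mulN1r !mulNr f1 opprK IH -natr1; ring.
Qed.

(* A completely monotone [D 0] vanishing on [c, +oo[ satisfies
   [n * D 0 (c - d) <= D 0 (c - 2 * d)] for every [n]. *)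
Lemma completely_monotone_gt0 (R : realType) (D : nat -> R -> R) :
  der_family `]0, +oo[ D -> (forall n x, 0 < x -> 0 <= (-1) ^+ n * D n x) ->
  (exists2 x, 0 < x & D 0 x != 0) -> forall x, 0 < x -> 0 < D 0 x.
Proof.
move=> dD D0 [x1 x10 Dx1].
have D00 x : 0 < x -> 0 <= D 0 x by move=> /(D0 0%N); rewrite expr0 mul1r.
have decr x y : 0 < x -> x <= y -> D 0 y <= D 0 x.
  move=> x0; rewrite le_eqVlt => /predU1P[->//|xy].
  have [|c [xc cy E]] := mvt_upclosed (@upclosed_pos R) (dD 0%N) _ xy.
    by rewrite pos_itv.
  rewrite -subr_le0 E mulr_le0_ge0 ?subr_ge0 ?(ltW xy)//.
  by have := D0 1%N c (lt_trans x0 xc); rewrite expr1 mulN1r oppr_ge0.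
(* With [d = c / 4] both sample points stay positive, and a zero at [c] moves down to [3 / 4] of
   [c]. *)
have step c : 0 < c -> D 0 c = 0 -> D 0 (c - c / 4) = 0.
  move=> c0 Dc0; have d0 : 0 < c / 4 by rewrite divr_gt0.
  have Dc x : c <= x -> D 0 x = 0.
    move=> cx; apply/eqP; rewrite eq_le D00 ?(lt_le_trans c0)// andbT -Dc0.
    exact: decr.
  have x0 : 0 < c - c / 4 - c / 4 by lra.
  have x0' : 0 < c - c / 4 by lra.
  have h n : n%:R * D 0 (c - c / 4) <= D 0 (c - c / 4 - c / 4).
    rewrite -subr_ge0 -(fin_diff_vanishing n d0 Dc).
    exact: completely_monotone_fin_diff.
  apply/eqP; rewrite eq_le D00// andbT leNgt; apply/negP => Dgt0.
  have := h (Num.trunc (D 0 (c - c / 4 - c / 4) / D 0 (c - c / 4))).+1.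
  by rewrite -ler_pdivlMr// leNgt truncnS_gt.
move=> x x0; rewrite lt_neqAle D00// andbT eq_sym; apply/eqP => Dx0.
(* These zeros tend to 0, hence pass below [x1], and monotonicity then gives [D 0 x1 = 0]. *)
have Dk k : D 0 (x * (3 / 4) ^+ k) = 0.
  elim: k => [|k IH]; first by rewrite expr0 mulr1.
  rewrite exprSr; set y := x * _ in IH.
  have -> : x * ((3 / 4) ^+ k * (3 / 4)) = y - y / 4 by rewrite /y; field.
  by apply: step => //; rewrite mulr_gt0// exprn_gt0.
have : x * (3 / 4) ^+ k @[k --> \oo] --> (0 : R).
  by apply: cvg0M; apply: cvg_expr; rewrite ger0_norm//; lra.
move=> /cvgr_lt/(_ _ x10)[k _ /(_ k (leqnn _))] xk.
have yk : 0 < x * (3 / 4) ^+ k by rewrite mulr_gt0// exprn_gt0.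
have := decr _ _ yk (ltW xk); rewrite Dk => h.
by move: Dx1; rewrite eq_le h D00.
Qed.

(** * Convolution with exponential factors *)

Lemma integrable_setU_disjoint d (T : measurableType d) (R : realType)
    (mu : {measure set T -> \bar R}) (A B : set T) (f : T -> \bar R) :
  measurable A -> measurable B -> [disjoint A & B] ->
  mu.-integrable A f -> mu.-integrable B f -> mu.-integrable (A `|` B) f.
Proof.
move=> mA mB AB /integrableP[mfA fA] /integrableP[mfB fB].
have mf : measurable_fun (A `|` B) f by apply/measurable_funU.
apply/integrableP; split => //.
rewrite ge0_integral_setU//; last exact: measurableT_comp.
by rewrite lte_add_pinfty.
Qed.

Lemma continuous_pos_measurable (R : realType) (w : R -> R) :
  (forall x, 0 < x -> {for x, continuous w}) ->
  measurable_fun (`]0, +oo[ : set (measurableTypeR R)) w.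
Proof.
move=> cw; apply: open_continuous_measurable_fun; first exact: open_pos.
by move=> x; rewrite inE/= in_itv/= andbT; exact: cw.
Qed.

Lemma integrable_near0_itv (R : realType) (w : R -> R) (b : R) :
  (forall x, 0 < x -> {for x, continuous w}) -> integrable_near0 w ->
  (@lebesgue_measure R).-integrable `]0, b] (EFin \o w).
Proof.
move=> cw [e e0 we].
have mu_e : (@lebesgue_measure R).-integrable `[e, Num.max e b] (EFin \o w).
  apply: continuous_compact_integrable; first exact: segment_compact.
  apply: continuous_in_subspaceT => x; rewrite inE/= in_itv/= => /andP[ex _].
  by apply: cw; exact: lt_le_trans ex.
apply: (integrableS _ _ _ (integrable_setU_disjoint _ _ _ we mu_e)) => //.
- exact: measurableU.
- move=> x /=; rewrite !in_itv/= => /andP[x0 xb]; have [ex|xe] := leP e x.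
    by right; rewrite le_max xb orbT.
  by left; rewrite x0.
- apply/disj_setPS => x /= []; rewrite !in_itv/= => /andP[_ xe] /andP[ex _].
  by move: xe; rewrite ltNge ex.
Qed.

Definition primitive0 (R : realType) (w : R -> R) (x : R) : R :=
  \int[@lebesgue_measure R]_(y in `]0, x]) w y.

Lemma is_derive_primitive0 (R : realType) (w : R -> R) (x : R) :
  (forall x, 0 < x -> {for x, continuous w}) -> integrable_near0 w ->
  0 < x -> is_derive x 1 (primitive0 w) (w x).
Proof.
move=> cw w0 x0; have xx1 : x < x + 1 by rewrite ltrDl.
have a0 : (BRight 0 < BRight x)%O by rewrite bnd_simp.
have [d E] := @continuous_FTC1 R w (BRight 0) x (x + 1) xx1
  (integrable_near0_itv (x + 1) cw w0) a0 (cw x x0).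
by apply: DeriveDef; [exact: d|rewrite -derive1E].
Qed.

Lemma cvg_primitive0 (R : realType) (w : R -> R) :
  (forall x, 0 < x -> {for x, continuous w}) -> integrable_near0 w ->
  primitive0 w x @[x --> 0^'+] --> (0 : R).
Proof.
move=> cw w0; have iw := integrable_near0_itv 1 cw w0.
have iw' : (@lebesgue_measure R).-integrable `[0, 1] (EFin \o (w \_ `]0, 1])).
  rewrite -restrict_EFin; apply/integrable_restrict => //=.
  by apply: integrableS iw => //; exact: measurableI.
have := parameterized_integral_cvg_left ltr01 iw'.
move=> /cvg_at_right_filter; apply: cvg_trans; apply: near_eq_cvg; near=> x.
rewrite /primitive0 /parameterized_integral -Rintegral_mkcondr.
congr (Rintegral _ _ _); apply/seteqP; split => y /=; rewrite !in_itv/=.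
  by move=> [/andP[_ ->] /andP[->]].
move=> /andP[y0 yx]; rewrite y0 yx (ltW y0) (le_trans yx)//.
by near: x; exact: nbhs_right_le.
Unshelve. all: by end_near. Qed.

Lemma integrable_near0_mul (R : realType) (w v : R -> R) :
  (forall x, {for x, continuous v}) -> 
  (forall x, 0 < x -> {for x, continuous w}) -> integrable_near0 w ->
  integrable_near0 (fun x => v x * w x).
Proof.
move=> cv cw w0; exists 1 => //.
have [M [_ vM]] : bounded_set (v @` `[0, 1]).
  apply/compact_bounded/continuous_compact; last exact: segment_compact.
  exact: continuous_subspaceT.
have iw : (@lebesgue_measure R).-integrable `]0, 1[ (EFin \o w).
  apply: (integrableS _ _ _ (integrable_near0_itv 1 cw w0)) => //.
  by move=> x /=; rewrite !in_itv/= => /andP[-> /ltW].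
apply: (le_integrable _ _ _ (integrableZl _ (M + 1) iw)) => //.
- apply/measurable_EFinP/measurable_funM.
    by apply: measurable_funTS; apply: continuous_measurable_fun.
  apply: measurable_funS (continuous_pos_measurable cw) => //.
  by move=> x /=; rewrite !in_itv/= andbT => /andP[].
- move=> x /=; rewrite in_itv/= => /andP[x0 x1].
  rewrite lee_fin !normrM ler_wpM2r// (le_trans _ (ler_norm _))//.
  apply: vM; first by rewrite ltrDl.
  by exists x => //=; rewrite in_itv/= !ltW.
Qed.

Lemma continuous_expRM (R : realType) (a x : R) :
  {for x, continuous (fun y => expR (a * y))}.
Proof.
apply: continuous_comp; last exact: continuous_expR.
by apply: cvgMl_tmp; exact: cvg_id.
Qed.

Lemma continuous_pos_expRM (R : realType) (a : R) (u : R -> R) :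
  (forall x, 0 < x -> {for x, continuous u}) ->
  forall x, 0 < x -> {for x, continuous (fun y => expR (a * y) * u y)}.
Proof. by move=> cu x x0; apply: cvgM; [exact: continuous_expRM|exact: cu]. Qed.

Lemma integrable_near0_expRM (R : realType) (a : R) (u : R -> R) :
  (forall x, 0 < x -> {for x, continuous u}) -> integrable_near0 u ->
  integrable_near0 (fun y => expR (a * y) * u y).
Proof. by apply: integrable_near0_mul => x; exact: continuous_expRM. Qed.

Lemma primitive0_itvoo (R : realType) (w : R -> R) (x : R) :
  (forall x, 0 < x -> {for x, continuous w}) -> integrable_near0 w ->
  \int[@lebesgue_measure R]_(y in `]0, x[) w y = primitive0 w x.
Proof.
move=> cw w0; rewrite /primitive0 -Rintegral_itv_bndo_bndc//.
apply: (integrableS _ _ _ (integrable_near0_itv x cw w0)) => //.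
by move=> y /=; rewrite !in_itv/= => /andP[-> /ltW].
Qed.

(** The exponential of [x - y] splits, so the convolution becomes a weighted primitive and the
    fundamental theorem of calculus applies. *)
Lemma conv_exp_factorE (R : realType) (a x : R) (u : R -> R) :
  (forall x, 0 < x -> {for x, continuous u}) -> integrable_near0 u ->
  conv (exp_factor a) u x =
  a^-1 * (expR (- a^-1 * x) * primitive0 (fun y => expR (a^-1 * y) * u y) x).
Proof.
move=> cu u0; rewrite /conv /exp_factor.
have cw := continuous_pos_expRM (a := a^-1) cu.
have w0 := integrable_near0_expRM a^-1 cu u0.
rewrite -primitive0_itvoo// mulrA -RintegralZl//; last first.
  apply: (integrableS _ _ _ (integrable_near0_itv x cw w0)) => //.
  by move=> y /=; rewrite !in_itv/= => /andP[-> /ltW].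
apply: eq_Rintegral => y _.
have -> : expR (- (x - y) / a) = expR (- a^-1 * x) * expR (a^-1 * y).
  by rewrite -expRD; congr expR; ring.
by ring.
Qed.

Lemma is_derive_conv_exp_factor (R : realType) (a x : R) (u : R -> R) :
  0 < a ->
  (forall x, 0 < x -> {for x, continuous u}) -> integrable_near0 u ->
  0 < x -> is_derive x 1 (conv (exp_factor a) u) ((u x - conv (exp_factor a) u x) / a).
Proof.
move=> a0 cu u0 x0.
have -> : conv (exp_factor a) u = fun x => a^-1 *
    (expR (- a^-1 * x) * primitive0 (fun y => expR (a^-1 * y) * u y) x).
  by apply/funext => y; rewrite conv_exp_factorE.
have cw := continuous_pos_expRM (a := a^-1) cu.
have w0 := integrable_near0_expRM a^-1 cu u0.
have h1 := is_derive_expR_mul (- a^-1) (is_derive_primitive0 cw w0 x0).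
have h2 := is_deriveM (is_derive_cst a^-1 x 1) h1.
apply: is_derive_eq h2 _; rewrite /GRing.scale/= mulNr expRN.
by field; apply/andP; split; rewrite gt_eqF ?expR_gt0.
Qed.

Lemma cvg_conv_exp_factor (R : realType) (a : R) (u : R -> R) :
  (forall x, 0 < x -> {for x, continuous u}) -> integrable_near0 u ->
  conv (exp_factor a) u x @[x --> 0^'+] --> (0 : R).
Proof.
move=> cu u0.
have -> : conv (exp_factor a) u = fun x => a^-1 *
    (expR (- a^-1 * x) * primitive0 (fun y => expR (a^-1 * y) * u y) x).
  by apply/funext => y; rewrite conv_exp_factorE.
have cw := continuous_pos_expRM (a := a^-1) cu.
have w0 := integrable_near0_expRM a^-1 cu u0.
apply: cvg0M; rewrite -[X in _ --> X](mulr0 (expR (- a^-1 * 0))); apply: cvgM.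
  by apply: cvg_at_right_filter; exact: continuous_expRM.
exact: cvg_primitive0.
Qed.

(* [expR (x / a) * (h x - k x)] is constant, with limit zero at zero. *)
Lemma ode_unique (R : realType) (a : R) (u h k : R -> R) :
  a != 0 ->
  (forall x : R, 0 < x -> is_derive x 1 h ((u x - h x) / a)) ->
  (forall x : R, 0 < x -> is_derive x 1 k ((u x - k x) / a)) ->
  h x @[x --> 0^'+] --> (0 : R) -> k x @[x --> 0^'+] --> (0 : R) ->
  forall x, 0 < x -> h x = k x.
Proof.
move=> a0 dh dk h0 k0 x x0.
pose K (y : R) := expR (a^-1 * y) * (h y - k y).
have dK (y : R) : `]0, +oo[%classic y -> is_derive y 1 K ((fun=> 0) y).
  rewrite pos_itv => y0; have h1 := dh y y0; have h2 := dk y y0.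
  have := is_derive_expR_mul a^-1 (is_deriveB h1 h2).
  by move=> h3; apply: is_derive_eq h3 _; rewrite !fctE; ring.
have K0 : K y @[y --> 0^'+] --> (0 : R).
  rewrite -[X in _ --> X](mulr0 (expR (a^-1 * 0))); apply: cvgM; last exact: cvg0B.
  by apply: cvg_at_right_filter; exact: continuous_expRM.
have Kx y : 0 < y -> y < x -> K y = K x.
  move=> y0 yx; have [|c [_ _ /eqP]] := mvt_upclosed (@upclosed_pos R) dK _ yx.
    by rewrite pos_itv.
  by rewrite mul0r subr_eq0 => /eqP.
have : K x = 0.
  apply/eqP; rewrite -normr_le0 leNgt; apply/negP => Kx0.
  near (0 : R)^'+ => y.
  suff : `|K x| < `|K x| by rewrite ltxx.
  rewrite -{1}(Kx y); [|by near: y; exact: nbhs_right_gt|by near: y; exact: nbhs_right_lt].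
  by near: y; exact: cvgr0_norm_lt K0 _ Kx0.
move/eqP; rewrite /K mulf_eq0 gt_eqF ?expR_gt0//= subr_eq0 => /eqP.
Unshelve. all: by end_near. Qed.

(** The integrals of [w] over intervals increasing to []0, 1]] are increments of [K], which
    converge; monotone convergence makes the limit the integral. *)
Lemma integrable_near0_derive (R : realType) (K w : R -> R) :
  (forall x, 0 < x -> {for x, continuous w}) ->
  (forall x, 0 < x -> 0 <= w x) ->
  (forall x : R, 0 < x -> is_derive x 1 K (w x)) ->
  K x @[x --> 0^'+] --> (0 : R) -> integrable_near0 w.
Proof.
move=> cw w0 dK K0; exists 1 => //.
(* The shift by 2 makes even the first interval nondegenerate. *)
pose F (i : nat) : set R := `[i.+2%:R^-1, 1]%classic.
have Fpos i x : F i x -> 0 < x.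
  by rewrite /F/= in_itv/= => /andP[h _]; apply: lt_le_trans h; rewrite invr_gt0.
have mF : (@lebesgue_measure R).-integrable (\bigcup_i F i) (EFin \o w).
  have mw : measurable_fun (\bigcup_i F i) (EFin \o w).
    apply/measurable_EFinP.
    apply: measurable_funS (continuous_pos_measurable cw) => // x [i _ /Fpos].
    by rewrite /= in_itv/= andbT.
  apply/integrableP; split => //.
  have -> : (\int[@lebesgue_measure R]_(x in \bigcup_i F i) `|(EFin \o w) x| =
      \int[@lebesgue_measure R]_(x in \bigcup_i F i) (w x)%:E)%E.
    apply: eq_integral => x; rewrite inE => -[i _ /Fpos x0] /=.
    by rewrite ger0_norm// w0.
  have FE i : (\int[@lebesgue_measure R]_(x in F i) (w x)%:E =
      (K 1)%:E - (K i.+2%:R^-1)%:E)%E.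
    apply: (continuous_FTC2 (F := K)).
    - by rewrite invf_lt1// ltr1n.
    - apply: continuous_in_subspaceT => x; rewrite inE => /Fpos; exact: cw.
    - have cK x : 0 < x -> {for x, continuous K}.
        by move=> x0; have := dK x x0 => h; exact: is_derive_continuous h.
      split.
      + move=> x; rewrite in_itv/= => /andP[h _].
        by have [] := dK x (lt_trans _ h); rewrite ?invr_gt0.
      + by apply: cvg_at_right_filter; apply: cK; rewrite invr_gt0.
      + by apply: cvg_at_left_filter; apply: cK.
    - move=> x; rewrite in_itv/= => /andP[h _].
      have x0 : 0 < x by apply: lt_trans h; rewrite invr_gt0.
      by rewrite derive1E; have := dK x x0 => hx; rewrite (@derive_val _ _ _ _ _ _ _ hx).
  have homoF : {homo F : n m / (n <= m)%N >-> (n <= m)%O}.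
    move=> n k nk; apply/subsetPset => x; rewrite /F/= !in_itv/= => /andP[nx ->].
    by rewrite andbT; apply: le_trans nx; rewrite lef_pV2 ?posrE// ler_nat !ltnS.
  have mFi i : measurable (F i) by exact: measurable_itv.
  have wFi i : measurable_fun (F i) (fun x => (w x)%:E).
    apply: measurable_funS mw => //; first exact: bigcup_measurable.
    exact: bigcup_sup.
  have pFi i x : F i x -> (0 <= (w x)%:E)%E by move=> /Fpos x0; rewrite lee_fin w0.
  have : (\int[@lebesgue_measure R]_(x in F i) (w x)%:E)%E @[i --> \oo] -->
      (\int[@lebesgue_measure R]_(x in \bigcup_i F i) (w x)%:E)%E.
    exact: ge0_nondecreasing_set_cvg_integral.
  under eq_fun do rewrite FE.
  have Kinv : K (i.+2%:R^-1) @[i --> \oo] --> (0 : R).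
    apply: ((cvg_at_rightP K 0 0).1 K0); split=> [i|]; first by rewrite invr_gt0.
    by have := @cvg_harmonic R; rewrite -(cvg_shiftS (@harmonic R)).
  have lim : ((K 1)%:E - (K i.+2%:R^-1)%:E)%E @[i --> \oo] --> (K 1)%:E.
    rewrite -[X in _ --> X]sube0; apply: cvgeB => //; first exact: cvg_cst.
    by apply: cvg_EFin Kinv; exact: nearW.
  by move=> /(cvg_unique _ lim) <-//; rewrite ltry.
apply: integrableS mF => //.
- by apply: bigcup_measurable => i _; exact: measurable_itv.
- move=> x /=; rewrite in_itv/= => /andP[x0 x1].
  have := near_infty_natSinv_lt (PosNum x0) => -[N _ NP].
  exists N => //; rewrite /F/= in_itv/= (ltW x1) andbT.
  exact/ltW/(NP N.+1)/leqnSn.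
Qed.

Lemma integrable_near0_cvg0 (R : realType) (w : R -> R) :
  (forall x, 0 < x -> {for x, continuous w}) ->
  w x @[x --> 0^'+] --> (0 : R) -> integrable_near0 w.
Proof.
move=> cw /cvgr0_norm_lt/(_ _ ltr01)[e /= e0 we]; exists e => //.
have mw : measurable_fun (`]0, e[ : set (measurableTypeR R)) w.
  apply: measurable_funS (continuous_pos_measurable cw) => //.
  by move=> x /=; rewrite !in_itv/= andbT => /andP[].
apply: measurable_bounded_integrable => //.
  by rewrite /= lebesgue_measure_itv/= lte_fin e0 sube0 ltry.
exists 1; split; first exact: num_real.
move=> M M1 x; rewrite /= in_itv/= => /andP[x0 xe].
apply: le_trans (ltW M1); apply/ltW/we => //=.
by rewrite sub0r normrN gtr0_norm.
Qed.

Lemma der_family_continuous (R : realType) (D : nat -> R -> R) n (x : R) :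
  der_family `]0, +oo[ D -> 0 < x -> {for x, continuous (D n)}.
Proof.
by move=> dD; rewrite -pos_itv => /(dD n) h; exact: is_derive_continuous h.
Qed.

(** * The equivalence *)

Lemma whale_family_conv (R : realType) m (D : nat -> R -> R) (a : R) :
  0 < a -> whale_family m D -> (forall x, 0 < x -> 0 < D 0 x) ->
  integrable_near0 (D 0) ->
  exists E : nat -> R -> R, [/\ whale_family m.+1 E,
    E 0 = conv (exp_factor a) (D 0), forall x, 0 < x -> 0 < E 0 x &
    integrable_near0 (E 0)].
Proof.
move=> a0 W D0 iD; have [dD _ _ _ _] := W.
have cD x : 0 < x -> {for x, continuous (D 0)} by exact: der_family_continuous.
have [|E [WE E0 hpos]] := whale_family_ode a0 W (fun x => is_derive_conv_exp_factor a0 cD iD).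
  exact: cvg_conv_exp_factor.
exists E; split => //; first by rewrite E0; exact: hpos.
have [dE _ _ vE _] := WE.
apply: integrable_near0_cvg0; last exact: vE.
by move=> x; exact: der_family_continuous.
Qed.

Lemma eq_conv_exp_factor (R : realType) (a : R) (u v : R -> R) :
  (forall x, 0 < x -> u x = v x) ->
  conv (exp_factor a) u = conv (exp_factor a) v.
Proof.
move=> uv; apply/funext => x; apply: eq_Rintegral => y.
by rewrite inE/= in_itv/= => /andP[y0 _]; rewrite uv.
Qed.

Lemma whale_family_conv_exp_factors (R : realType) (s : seq R) (D : nat -> R -> R) :
  all (> 0) s -> whale_family 0 D -> (forall x, 0 < x -> 0 < D 0 x) ->
  integrable_near0 (D 0) ->
  exists E : nat -> R -> R, [/\ whale_family (size s) E,
    E 0 = conv_exp_factors s (D 0), forall x, 0 < x -> 0 < E 0 x &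
    integrable_near0 (E 0)].
Proof.
move=> + W D0 iD; elim: s => [_|a s IH] /=; first by exists D.
move=> /andP[a0 /IH[E [WE E0 Epos iE]]].
by have := whale_family_conv a0 WE Epos iE; rewrite E0.
Qed.

(** Integrability near 0 comes from positivity: [expR (y / a) * (D 0 y + a * D 1 y)] is the
    derivative of [a * expR (y / a) * D 0 y], which tends to zero. Both sides of the identity then
    solve the same equation with limit zero at 0. *)
Lemma conv_exp_factor_unique (R : realType) (a : R) (D : nat -> R -> R) :
  0 < a -> der_family `]0, +oo[ D -> D 0 x @[x --> 0^'+] --> (0 : R) ->
  (forall x, 0 < x -> 0 <= D 0 x + a * D 1 x) ->
  integrable_near0 (fun x => D 0 x + a * D 1 x) /\
  forall x, 0 < x -> D 0 x = conv (exp_factor a) (fun x => D 0 x + a * D 1 x) x.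
Proof.
move=> a0 dD D00 U0; set u := fun x => D 0 x + a * D 1 x.
have cu x : 0 < x -> {for x, continuous u}.
  move=> x0; apply: cvgD; first exact: der_family_continuous.
  by apply: cvgMl_tmp; exact: der_family_continuous.
have an0 : a != 0 by rewrite gt_eqF.
have iu : integrable_near0 u.
  pose K (y : R) := a * (expR (a^-1 * y) * D 0 y).
  have iw : integrable_near0 (fun y => expR (a^-1 * y) * u y).
    apply: (@integrable_near0_derive _ K).
    - exact: continuous_pos_expRM.
    - by move=> x x0; rewrite mulr_ge0 ?expR_ge0 ?U0.
    - move=> x x0; have Ix : `]0, +oo[%classic x by rewrite pos_itv.
      have h1 := is_derive_expR_mul a^-1 (dD 0%N x Ix).
      have h2 := is_deriveM (is_derive_cst a x 1) h1.
      by apply: is_derive_eq h2 _; rewrite /GRing.scale/= /u; field.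
    - apply: cvg0M; rewrite -[X in _ --> X](mulr0 (expR (a^-1 * 0))); apply: cvgM => //.
      by apply: cvg_at_right_filter; exact: continuous_expRM.
  have : integrable_near0 (fun y => expR (- a^-1 * y) * (expR (a^-1 * y) * u y)).
    by apply: integrable_near0_expRM iw; exact: continuous_pos_expRM.
  congr integrable_near0; apply/funext => y.
  by rewrite mulrA -expRD mulNr addNr expR0 mul1r.
split=> // x x0.
apply: (ode_unique an0 (u := u)) x0 => //; last exact: cvg_conv_exp_factor.
- move=> y y0; have Iy : `]0, +oo[%classic y by rewrite pos_itv.
  have h1 := dD 0%N y Iy; apply: is_derive_eq h1 _.
  by rewrite /u; field.
- by move=> y y0; exact: is_derive_conv_exp_factor.
Qed.

Lemma whale_family_decomposition (R : realType) m (D : nat -> R -> R) :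
  whale_family m D -> (m = 0%N -> integrable_near0 (D 0)) ->
  exists (alpha : m.-tuple R) (E : nat -> R -> R),
    [/\ forall j : 'I_m, 0 < tnth alpha j, whale_family 0 E,
        integrable_near0 (E 0) &
        forall x, 0 < x -> D 0 x = conv_exp_factors alpha (E 0) x].
Proof.
elim: m D => [|m IH] D W iD.
  by exists [tuple], D; split => //; [case|exact: iD].
have [a a0 WU] := whale_family_factor W.
have [dD _ _ vD _] := W; have [_ [U0 _] _ _ _] := WU.
have [iU DE] := conv_exp_factor_unique a0 dD (vD 0%N isT) U0.
have [alpha [E [alpha0 WE iE UE]]] := IH _ WU (fun=> iU).
exists [tuple of a :: alpha], E; split => //.
- by move=> j; case: (unliftP ord0 j) => [i|] ->; rewrite ?tnthS.
- by move=> x x0; rewrite DE// (eq_conv_exp_factor a UE).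
Qed.

Theorem whale_shaped_iff (R : realType) (m : nat) (f : R -> R) :
  ((whale_shaped m f /\ (m = 0%N -> integrable_near0 f)) <->
   (exists (alpha : m.-tuple R) (g : R -> R),
      [/\ forall j : 'I_m, 0 < tnth alpha j,
          completely_monotone g,
          exists2 x : R, 0 < x & g x != 0,
          g x @[x --> +oo] --> (0 : R) /\ integrable_near0 g &
          forall x : R, 0 < x -> f x = conv_exp_factors alpha g x])).
Proof.
split=> [[/whale_shaped_family W i0]|[alpha [g [a0 [sg g0] gn0 [ginf ig] fE]]]].
  have [alpha [E [a0 WE iE fE]]] := whale_family_decomposition W i0.
  have [dE [_ En0] Einf _ _] := WE.
  exists alpha, (E 0); split => //; split.
    exact: (der_family_smooth_on (@open_pos R) dE).
  move=> n x x0; rewrite (der_family_derive1n (@open_pos R) dE)// ?pos_itv//.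
  exact: whale_family0_completely_monotone.
have dg := smooth_on_der_family sg.
have gpos := completely_monotone_gt0 dg g0 gn0.
have Wg : whale_family 0 (fun n => derive1n n g).
  split => //.
    by split => // x /gpos/ltW.
  move=> n s [x [Ix _ sx]].
  (* Two values of opposite signs cannot both have the sign of [(-1) ^+ n]. *)
  have cpos j : (j <= 1)%N -> 0 < (-1) ^+ n * derive1n n g (x j).
    move=> j1; have xj0 : 0 < x j by rewrite -pos_itv; exact: Ix.
    rewrite lt_neqAle g0// andbT eq_sym.
    by rewrite mulf_neq0 ?signr_eq0//; apply: contraTneq (sx j j1) => ->; rewrite mulr0 ltxx.
  have := sx 1%N isT; have := same_sign_trans (sx 0%N isT) (cpos 0%N isT) (cpos 1%N isT).
  by rewrite expr0 expr1 mulr1 mulrN1 mulNr oppr_gt0 => /lt_trans h /h; rewrite ltxx.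
have sa : all (> 0) alpha.
  by apply/all_tnthP => j; exact: a0.
have [E [WE E0 Epos iE]] := whale_family_conv_exp_factors sa Wg gpos ig.
rewrite size_tuple in WE.
have fE0 x : 0 < x -> f x = E 0 x by move=> x0; rewrite E0 fE.
split; first exact: whale_family_shaped WE Epos fE0.
move=> _; case: iE => e e0 iE; exists e => //.
apply: eq_integrable iE => // x; rewrite inE/= in_itv/= => /andP[x0 _].
by rewrite fE0.
Qed.

(** * Gamma densities and their Gaussian limit *)

(** By Cauchy's formula, [n]! times the primitive of [w] iterated [n.+1] times. *)
Definition fractional_primitive (R : realType) (n : nat) (w : R -> R) (x : R) : R :=
  \int[@lebesgue_measure R]_(y in `]0, x]) ((x - y) ^+ n * w y).

Lemma continuous_mulX (R : realType) (w : R -> R) :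
  (forall x : R, 0 < x -> {for x, continuous w}) ->
  forall x : R, 0 < x -> {for x, continuous (fun y : R => y * w y)}.
Proof. by move=> cw x x0; apply: cvgM; [exact: cvg_id|exact: cw]. Qed.

Lemma integrable_near0_mulX (R : realType) (w : R -> R) :
  (forall x : R, 0 < x -> {for x, continuous w}) -> integrable_near0 w ->
  integrable_near0 (fun y : R => y * w y).
Proof. by move=> cw; apply: integrable_near0_mul => // x; exact: cvg_id. Qed.

Lemma integrable_fractional (R : realType) (n : nat) (w : R -> R) (x b : R) :
  (forall x : R, 0 < x -> {for x, continuous w}) -> integrable_near0 w ->
  (@lebesgue_measure R).-integrable `]0, b] (EFin \o (fun y : R => (x - y) ^+ n * w y)).
Proof.
move=> cw w0; have cp z : {for z, continuous (fun y : R => (x - y) ^+ n)}.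
  apply: (@continuous_comp _ _ _ (fun y : R => x - y) (fun v => v ^+ n)); last exact: exprn_continuous.
  by apply: cvgB; [exact: cvg_cst|exact: cvg_id].
apply: integrable_near0_itv; last exact: integrable_near0_mul.
by move=> z z0; apply: cvgM; [exact: cp|exact: cw].
Qed.

(** Expanding one factor [x - y] lowers [n], so that the derivative follows by induction from that
    of [primitive0], without differentiation under the integral. *)
Lemma fractional_primitiveS (R : realType) (n : nat) (w : R -> R) (x : R) :
  (forall x : R, 0 < x -> {for x, continuous w}) -> integrable_near0 w ->
  fractional_primitive n.+1 w x =
  x * fractional_primitive n w x - fractional_primitive n (fun y : R => y * w y) x.
Proof.
move=> cw w0; rewrite /fractional_primitive -RintegralZl//; last exact: integrable_fractional.
rewrite -RintegralB//; last 2 first.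
- by have := integrableZl _ x (integrable_fractional n x x cw w0); apply.
- by apply: integrable_fractional; [exact: continuous_mulX|exact: integrable_near0_mulX].
by apply: eq_Rintegral => y _; rewrite exprS; ring.
Qed.

Lemma fractional_primitive0 (R : realType) (w : R -> R) :
  fractional_primitive 0 w = primitive0 w.
Proof. by apply/funext => x; apply: eq_Rintegral => y _; rewrite expr0 mul1r. Qed.

Lemma cvg_fractional_primitive (R : realType) (n : nat) (w : R -> R) :
  (forall x : R, 0 < x -> {for x, continuous w}) -> integrable_near0 w ->
  fractional_primitive n w x @[x --> 0^'+] --> (0 : R).
Proof.
elim: n w => [|n IH] w cw w0; first by rewrite fractional_primitive0; exact: cvg_primitive0.
have -> : fractional_primitive n.+1 w = fun x : R => x * fractional_primitive n w x -
    fractional_primitive n (fun y : R => y * w y) x.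
  by apply/funext => x; exact: fractional_primitiveS.
apply: cvg0B.
  rewrite -[X in _ --> X](mul0r 0); apply: cvgM; last exact: IH.
  by apply: cvg_at_right_filter; exact: cvg_id.
by apply: IH; [exact: continuous_mulX|exact: integrable_near0_mulX].
Qed.

Lemma is_derive_fractional_primitive (R : realType) (n : nat) (w : R -> R) (x : R) :
  (forall x : R, 0 < x -> {for x, continuous w}) -> integrable_near0 w -> 0 < x ->
  is_derive x 1 (fractional_primitive n.+1 w) (n.+1%:R * fractional_primitive n w x).
Proof.
move=> + + x0; elim: n w => [|n IH] w cw w0.
  have -> : fractional_primitive 1 w = fun x : R => x * primitive0 w x -
      primitive0 (fun y : R => y * w y) x.
    by apply/funext => y; rewrite fractional_primitiveS// !fractional_primitive0.
  have h1 := is_derive_primitive0 cw w0 x0.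
  have h2 := is_derive_primitive0 (continuous_mulX cw) (integrable_near0_mulX cw w0) x0.
  have h3 := is_deriveB (is_deriveM (is_derive_id x (1 : R)) h1) h2.
  by apply: is_derive_eq h3 _; rewrite /GRing.scale/= fractional_primitive0; ring.
have -> : fractional_primitive n.+2 w = fun x : R => x * fractional_primitive n.+1 w x -
    fractional_primitive n.+1 (fun y : R => y * w y) x.
  by apply/funext => y; rewrite fractional_primitiveS.
have h1 := IH w cw w0.
have h2 := IH _ (continuous_mulX cw) (integrable_near0_mulX cw w0).
have h3 := is_deriveB (is_deriveM (is_derive_id x (1 : R)) h1) h2.
apply: is_derive_eq h3 _; rewrite /GRing.scale/= fractional_primitiveS//.
by rewrite -(natr1 n.+1); ring.
Qed.

(* Up to a positive factor, [f] convolved with [n.+1] copies of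
   [exp_factor b]. *)
Definition gamma_conv (R : realType) (n : nat) (b : R) (f : R -> R) (x : R) : R :=
  \int[@lebesgue_measure R]_(y in `]0, x])
    ((x - y) ^+ n * expR (- b^-1 * (x - y)) * f y).

Lemma gamma_convE (R : realType) (n : nat) (b x : R) (f : R -> R) :
  (forall x : R, 0 < x -> {for x, continuous f}) -> integrable_near0 f ->
  gamma_conv n b f x =
  expR (- b^-1 * x) * fractional_primitive n (fun y : R => expR (b^-1 * y) * f y) x.
Proof.
move=> cf f0; rewrite /gamma_conv /fractional_primitive -RintegralZl//; last first.
  apply: integrable_fractional; first exact: continuous_pos_expRM.
  exact: integrable_near0_expRM.
apply: eq_Rintegral => y _.
have -> : expR (- b^-1 * (x - y)) = expR (- b^-1 * x) * expR (b^-1 * y).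
  by rewrite -expRD; congr expR; ring.
by ring.
Qed.

(** The suitably scaled functions [h j] solve the equation of [whale_family_ode] with source
    [h j.-1], so each step raises the order by one and no iterated convolution has to be reduced to
    a single integral. *)
Lemma whale_family_gamma_conv (R : realType) m (D : nat -> R -> R) (b : R) (n : nat) :
  0 < b -> whale_family m D -> integrable_near0 (D 0) ->
  exists2 k : R, 0 < k & exists2 E : nat -> R -> R, whale_family (m + n).+1 E &
    forall x, E 0 x = k * gamma_conv n b (D 0) x.
Proof.
move=> b0 W f0; have [dD _ _ _ _] := W; set f := D 0 in f0 *.
have cf x : 0 < x -> {for x, continuous f} by exact: der_family_continuous.
have bn0 : b != 0 by rewrite gt_eqF.
pose F (y : R) := expR (b^-1 * y) * f y.
have cF : forall x : R, 0 < x -> {for x, continuous F} by exact: continuous_pos_expRM.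
have F0 : integrable_near0 F by exact: integrable_near0_expRM.
(* The normalisation of the gamma density of shape [n.+1] and scale [b], which makes the equations
   hold exactly. *)
pose k (n : nat) : R := (n`!%:R * b ^+ n.+1)^-1.
have k0 j : 0 < k j by rewrite invr_gt0 mulr_gt0 ?exprn_gt0// ltr0n fact_gt0.
pose h j (x : R) := k j * (expR (- b^-1 * x) * fractional_primitive j F x).
suff [E WE E0] : exists2 E : nat -> R -> R, whale_family (m + n).+1 E & E 0 = h n.
  exists (k n) => //; exists E => // x; rewrite E0 /h -gamma_convE//.
have h0 j : h j x @[x --> 0^'+] --> (0 : R).
  apply: cvg0M; rewrite -[X in _ --> X](mulr0 (expR (- b^-1 * 0))); apply: cvgM.
    by apply: cvg_at_right_filter; exact: continuous_expRM.
  exact: cvg_fractional_primitive.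
elim: n => [|n [E WE E0]].
  have dh0 (x : R) : 0 < x -> is_derive x 1 (h 0%N) ((D 0 x - h 0%N x) / b).
    move=> x0; have h1 := is_derive_expR_mul (- b^-1) (is_derive_primitive0 cF F0 x0).
    have h2 := is_deriveM (is_derive_cst (k 0%N) x 1) h1.
    rewrite /h fractional_primitive0; apply: is_derive_eq h2 _.
    rewrite /GRing.scale/= /k /F fact0 expr1 mul1r mulNr expRN /f.
    by field; apply/andP; split; rewrite gt_eqF ?expR_gt0.
  have [E [WE E0 _]] := whale_family_ode b0 W dh0 (h0 0%N).
  by exists E; rewrite ?addn0.
have dhn (x : R) : 0 < x -> is_derive x 1 (h n.+1) ((E 0 x - h n.+1 x) / b).
  move=> x0; have h1 := is_derive_expR_mul (- b^-1) (is_derive_fractional_primitive n cF F0 x0).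
  have h2 := is_deriveM (is_derive_cst (k n.+1) x 1) h1.
  apply: is_derive_eq h2 _.
  rewrite /GRing.scale/= E0 /h.
  have -> : k n = k n.+1 * (b * n.+1%:R).
    rewrite /k factS natrM (exprS b n.+1); field.
    by rewrite bn0 expf_neq0// nat1r !pnatr_eq0 -lt0n fact_gt0.
  by field.
have [E' [WE' E0' _]] := whale_family_ode b0 WE dhn (h0 n.+1).
by exists E'; rewrite ?addnS.
Qed.

Definition gauss (R : realType) (s z : R) : R := expR (- z ^+ 2 / (s ^+ 2 *+ 2)).

(** In the logarithm of the gamma kernel the linear term of [ln (1 + w)] cancels and the quadratic
    one gives the Gaussian; this is what remains. *)
Definition ln_remainder (R : realType) (w : R) : R := ln (1 + w) - w + w ^+ 2 / 2.

Lemma ln_remainder_mvt (R : realType) (a b : R) : -1 < a -> a < b ->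
  exists c, [/\ a < c, c < b &
    ln_remainder b - ln_remainder a = c ^+ 2 / (1 + c) * (b - a)].
Proof.
move=> a1 ab.
have upI : upclosed (`]-1, +oo[%classic : set R).
  by move=> x y; rewrite /= !in_itv/= !andbT => x1 /(lt_le_trans x1).
apply: (mvt_upclosed upI _ _ ab (du := fun c => c ^+ 2 / (1 + c))); last first.
  by rewrite /= in_itv/= andbT.
move=> x; rewrite /= in_itv/= andbT => x1.
have x10 : 0 < 1 + x by lra.
have h1 := is_deriveD (is_derive_cst (1 : R) x 1) (is_derive_id x (1 : R)).
have h2 := @is_derive1_comp _ (@ln R) (cst 1 + id) x _ _ (is_derive1_ln x10) h1.
have h3 := is_deriveM (is_derive_id x (1 : R)) (is_derive_id x (1 : R)).
have h4 := is_deriveM h3 (is_derive_cst (2^-1 : R) x 1).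
have h5 := is_deriveD (is_deriveB h2 (is_derive_id x (1 : R))) h4.
apply: is_derive_eq h5 _; rewrite /GRing.scale/= !fctE; field.
by rewrite gt_eqF.
Qed.

Lemma ln_remainder0 (R : realType) : ln_remainder (0 : R) = 0.
Proof. by rewrite /ln_remainder addr0 ln1 expr0n/=; ring. Qed.

Lemma ln_remainder_le0 (R : realType) (w : R) :
  -1 < w -> w <= 0 -> ln_remainder w <= 0.
Proof.
move=> w1; rewrite le_eqVlt => /predU1P[->|w0]; first by rewrite ln_remainder0.
have [c [wc c0 E]] := ln_remainder_mvt w1 w0.
have : 0 <= c ^+ 2 / (1 + c) * (0 - w).
  have c1 : 0 <= 1 + c by lra.
  by rewrite mulr_ge0 ?divr_ge0 ?sqr_ge0//; lra.
by rewrite -E ln_remainder0 sub0r oppr_ge0.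
Qed.

(** The derivative is [c ^+ 2 / (1 + c)], and [1 + c] is at least one half; hence the constant 2. *)
Lemma ln_remainder_bound (R : realType) (w : R) :
  `|w| <= 2^-1 -> `|ln_remainder w| <= 2 * `|w| ^+ 3.
Proof.
have key (c d : R) : `|c| <= d -> d <= 2^-1 -> `|c ^+ 2 / (1 + c)| <= 2 * d ^+ 2.
  move=> cd d2; have := le_trans cd d2; rewrite ler_norml => /andP[c1 c2].
  have c0 : 0 < 1 + c by lra.
  rewrite normrM normrV ?unitf_gt0// (gtr0_norm c0) normrX ler_pdivrMr//.
  apply: (@le_trans _ _ (d ^+ 2)); first by rewrite lerXn2r ?nnegrE ?(le_trans _ cd).
  rewrite mulrAC ler_peMl ?sqr_ge0//; lra.
move=> w2; have := w2; rewrite ler_norml => /andP[w2n w2p].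
have [w0|w0|->] := ltgtP w 0; last first.
- by rewrite ln_remainder0 normr0 mulr_ge0// exprn_ge0.
- have [c [c0 cw]] := ln_remainder_mvt (ltrN10 _) w0.
  rewrite ln_remainder0 !subr0 => ->; rewrite normrM [`|w| ^+ 3]exprSr mulrA ler_wpM2r//.
  by apply: key => //; rewrite !gtr0_norm// ltW.
- have [|c [wc c0]] := ln_remainder_mvt _ w0; first lra.
  rewrite ln_remainder0 !sub0r => /eqP; rewrite eqr_oppLR => /eqP ->.
  rewrite mulrN opprK normrM [`|w| ^+ 3]exprSr mulrA ler_wpM2r//.
  by apply: key => //; rewrite !ltr0_norm// lerN2 ltW.
Qed.

(* The density of a sum of [q ^ 2 + 1] exponential variables of mean [s / q],
   shifted by [q * s] and normalised to have value 1 at 0. *)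
Definition gamma_kernel (R : realType) (q : nat) (s z : R) : R :=
  (Num.max 0 (1 + z / (q%:R * s)) * expR (- (z / (q%:R * s)))) ^+ (q ^ 2).

Lemma gamma_kernelE (R : realType) (q : nat) (s z : R) :
  (0 < q)%N -> 0 < s -> - 1 < z / (q%:R * s) ->
  gamma_kernel q s z =
  expR ((q ^ 2)%:R * ln_remainder (z / (q%:R * s))) * gauss s z.
Proof.
move=> q0 s0; rewrite /gamma_kernel /gauss; set w := z / _ => w1.
have w10 : 0 < 1 + w by lra.
have qn0 : q%:R != 0 :> R by rewrite pnatr_eq0 -lt0n.
have -> : Num.max 0 (1 + w) = expR (ln (1 + w)).
  by rewrite lnK ?posrE//; apply/max_idPr; exact: ltW.
rewrite -[in LHS]expRD -expRM_natl -expRD; congr expR.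
have -> : - z ^+ 2 / (s ^+ 2 *+ 2) = - (q ^ 2)%:R * (w ^+ 2 / 2).
  by rewrite /w natrX; field; rewrite qn0 gt_eqF.
by rewrite /ln_remainder; ring.
Qed.

Lemma gamma_kernel_ge0 (R : realType) (q : nat) (s z : R) :
  0 <= gamma_kernel q s z.
Proof. by rewrite exprn_ge0// mulr_ge0 ?expR_ge0// le_max lexx. Qed.

Lemma gamma_kernel_beyond (R : realType) (q : nat) (s z : R) :
  (0 < q)%N -> 0 < s -> z <= - (q%:R * s) -> gamma_kernel q s z = 0.
Proof.
move=> q0 s0 zq; have qs : 0 < q%:R * s by rewrite mulr_gt0// ltr0n.
have w1 : z / (q%:R * s) <= -1 by rewrite ler_pdivrMr// mulN1r.
rewrite /gamma_kernel (max_idPl _) ?mul0r ?expr0n; last lra.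
by rewrite expn_eq0 eqn0Ngt q0.
Qed.

Lemma gamma_kernel_le1 (R : realType) (q : nat) (s z : R) : gamma_kernel q s z <= 1.
Proof.
rewrite exprn_ile1// ?mulr_ge0 ?expR_ge0 ?le_max ?lexx//.
by rewrite expRN ler_pdivrMr ?expR_gt0// mul1r ge_max expR_ge0 expR_ge1Dx.
Qed.

Lemma gamma_kernel_le_gauss (R : realType) (q : nat) (s z : R) :
  (0 < q)%N -> 0 < s -> z <= 0 -> gamma_kernel q s z <= gauss s z.
Proof.
move=> q0 s0 z0; have qs : 0 < q%:R * s by rewrite mulr_gt0// ltr0n.
have [zq|zq] := leP z (- (q%:R * s)).
  by rewrite gamma_kernel_beyond// expR_ge0.
have w1 : -1 < z / (q%:R * s) by rewrite ltr_pdivlMr// mulN1r.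
rewrite gamma_kernelE// ler_piMl ?expR_ge0// -[leRHS]expR0 ler_expR.
rewrite mulr_ge0_le0// ln_remainder_le0// mulr_le0_ge0// invr_ge0.
exact: ltW.
Qed.

Lemma ln_remainder_scaled_bound (R : realType) (q : nat) (s z : R) :
  (0 < q)%N -> 0 < s -> `|z / (q%:R * s)| <= 2^-1 ->
  `|(q ^ 2)%:R * ln_remainder (z / (q%:R * s))| <= 2 * (`|z| / s) ^+ 3 / q%:R.
Proof.
move=> q0 s0 /ln_remainder_bound h.
have qr0 : 0 < q%:R :> R by rewrite ltr0n.
rewrite natrX normrM ger0_norm ?sqr_ge0//.
apply: le_trans (ler_wpM2l _ h) _; first exact: sqr_ge0.
have qs0 : 0 < q%:R * s by rewrite mulr_gt0.
rewrite normrM normfV (gtr0_norm qs0).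
rewrite le_eqVlt; apply/orP; left; apply/eqP.
by field; rewrite !gt_eqF.
Qed.

Lemma cvg_gamma_kernel (R : realType) (s z : R) : 0 < s ->
  gamma_kernel q.+1 s z @[q --> \oo] --> gauss s z.
Proof.
move=> s0; pose w q := z / (q.+1%:R * s).
have wE q : w q = z / s * harmonic q.
  by rewrite /w /harmonic/= invfM; ring.
have w0 : w q @[q --> \oo] --> (0 : R).
  by under eq_fun do rewrite wE; apply: cvg0M; exact: cvg_harmonic.
have r0 : (q.+1 ^ 2)%:R * ln_remainder (w q) @[q --> \oo] --> (0 : R).
  apply: norm_cvg0.
  apply: (@squeeze_cvgr _ _ _ _ (cst 0) (fun q => 2 * (`|z| / s) ^+ 3 * harmonic q)).
  - move/cvgr0_norm_le: w0 => /(_ 2^-1) w0.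
    near=> q; rewrite normr_ge0/=; apply: ln_remainder_scaled_bound => //.
    by near: q; apply: w0.
  - exact: cvg_cst.
  - by apply: cvg0M; exact: cvg_harmonic.
rewrite -[X in _ --> X]mul1r.
have : expR ((q.+1 ^ 2)%:R * ln_remainder (w q)) * gauss s z @[q --> \oo] --> 1 * gauss s z.
  apply: cvgMr_tmp; rewrite -[X in _ --> X]expR0.
  exact: (cvg_comp _ _ r0 (@continuous_expR R 0)).
apply: cvg_trans; apply: near_eq_cvg; near=> q.
rewrite gamma_kernelE//.
suff : `|w q| < 1 by rewrite ltr_norml => /andP[].
by near: q; exact: cvgr0_norm_lt w0 _ ltr01.
Unshelve. all: by end_near. Qed.

Lemma normal_pdf_gauss (R : realType) (s x y : R) : s != 0 ->
  normal_pdf x s y = normal_peak s * gauss s (x - y).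
Proof.
move=> s0; transitivity (normal_peak s * normal_fun x s y).
  by rewrite normal_pdfE.
by congr (_ * expR _); ring.
Qed.

Lemma integrable_gauss (R : realType) (s x : R) : s != 0 ->
  (@lebesgue_measure R).-integrable setT (EFin \o (fun y => gauss s (x - y))).
Proof.
move=> s0; have := integrableZl measurableT (normal_peak s)^-1 (integrable_normal_pdf x s).
apply: eq_integrable => // y _ /=; rewrite -EFinM normal_pdf_gauss// mulrA mulVf ?mul1r//.
by rewrite gt_eqF// normal_peak_gt0.
Qed.

Lemma Rintegral_gauss (R : realType) (s x : R) : s != 0 ->
  \int[@lebesgue_measure R]_y gauss s (x - y) = (normal_peak s)^-1.
Proof.
move=> s0; have p0 : normal_peak s != 0 by rewrite gt_eqF// normal_peak_gt0.
apply: (mulfI p0); rewrite -RintegralZl//; last exact: integrable_gauss.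
rewrite divff// /Rintegral; under eq_integral do rewrite -normal_pdf_gauss//.
by rewrite integral_normal_pdf.
Qed.

Lemma continuous_gauss (R : realType) (s x : R) (y : R) :
  {for y, continuous (fun y : R => gauss s (x - y))}.
Proof.
apply: (@continuous_comp _ _ _ (fun y : R => - (x - y) ^+ 2 / (s ^+ 2 *+ 2)) expR);
  last exact: continuous_expR.
apply: cvgMr_tmp; apply: cvgN.
apply: (@continuous_comp _ _ _ (fun y : R => x - y) (fun v => v ^+ 2)); last exact: exprn_continuous.
by apply: cvgB; [exact: cvg_cst|exact: cvg_id].
Qed.

Lemma gaussN (R : realType) (s z : R) : gauss s (- z) = gauss s z.
Proof. by rewrite /gauss sqrrN. Qed.

Lemma gauss_ge0 (R : realType) (s z : R) : 0 <= gauss s z.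
Proof. exact: expR_ge0. Qed.

(** Completing the square. *)
Lemma expR_gauss (R : realType) (s a y : R) : s != 0 ->
  expR (a * y) * gauss s y =
  expR (a ^+ 2 * s ^+ 2 / 2) * gauss s (a * s ^+ 2 - y).
Proof. by move=> s0; rewrite /gauss -!expRD; congr expR; field. Qed.

Lemma expR_gauss_bound (R : realType) (s a y z : R) : s != 0 -> `|z| <= 1 ->
  `|expR (a * y) * (gauss s y * z)| <=
  `|expR (a ^+ 2 * s ^+ 2 / 2) * gauss s (a * s ^+ 2 - y)|.
Proof. by move=> s0 z1; rewrite -expR_gauss// mulrA normrM ler_piMr. Qed.

Lemma integrable_gauss_weight (R : realType) (s a : R) (f : R -> R) :
  s != 0 -> (forall x : R, 0 < x -> {for x, continuous f}) ->
  integrable_near0 f -> f x @[x --> +oo] --> (0 : R) ->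
  (@lebesgue_measure R).-integrable `]0, +oo[
    (EFin \o (fun y : R => expR (a * y) * (gauss s y * f y))).
Proof.
move=> s0 cf f0 finf.
have cg (y : R) : {for y, continuous (fun y : R => gauss s y)}.
  suff -> : [eta gauss s] = fun y : R => gauss s (0 - y) by exact: continuous_gauss.
  by apply/funext => z; rewrite sub0r gaussN.
have cgf (y : R) : 0 < y -> {for y, continuous (fun y : R => gauss s y * f y)}.
  by move=> y0; apply: cvgM; [exact: cg|exact: cf].
have cw := continuous_pos_expRM (a := a) cgf.
have w0 := integrable_near0_expRM a cgf (integrable_near0_mul cg cf f0).
move/cvgr0_norm_lt: finf => /(_ _ ltr01)[M [_ fM]].
pose X := Num.max M 1; have X0 : 0 < X by rewrite lt_max ltr01 orbT.
have i1 := integrable_near0_itv X cw w0.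
have i2 : (@lebesgue_measure R).-integrable `]X, +oo[
    (EFin \o (fun y : R => expR (a * y) * (gauss s y * f y))).
  have ig : (@lebesgue_measure R).-integrable `]X, +oo[
      (EFin \o (fun y => gauss s (a * s ^+ 2 - y))).
    by apply: integrableS (integrable_gauss (a * s ^+ 2) s0).
  apply: le_integrable (integrableZl _ (expR (a ^+ 2 * s ^+ 2 / 2)) ig) => //.
    apply/measurable_EFinP; apply: measurable_funS (continuous_pos_measurable cw) => //.
    by move=> y /=; rewrite !in_itv/= !andbT; exact: lt_trans.
  move=> y; rewrite /= in_itv/= andbT => Xy.
  rewrite lee_fin; apply: expR_gauss_bound => //.
  by apply/ltW/fM; apply: le_lt_trans Xy; rewrite le_max lexx.
apply: (integrableS _ _ _ (integrable_setU_disjoint _ _ _ i1 i2)) => //.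
- exact: measurableU.
- move=> y /=; rewrite !in_itv/= !andbT => y0.
  by have [yX|Xy] := leP y X; [left; rewrite y0|right].
- apply/disj_setPS => y /= []; rewrite !in_itv/= andbT => /andP[_ yX].
  by rewrite ltNge yX.
Qed.

(** Separating [x] from [y] turns the Gaussian convolution into a Gaussian times a Laplace
    transform, from which its smoothness is obtained. *)
Lemma gaussB (R : realType) (s x y : R) : s != 0 ->
  gauss s (x - y) = gauss s x * (expR (x / s ^+ 2 * y) * gauss s y).
Proof. by move=> s0; rewrite /gauss -!expRD; congr expR; field. Qed.

Definition gauss_transform (R : realType) (s : R) (f : R -> R) (x : R) : R :=
  \int[@lebesgue_measure R]_(y in `]0, +oo[) (gauss s (x - y) * f y).

Lemma integrable_gauss_transform (R : realType) (s x : R) (f : R -> R) :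
  s != 0 -> (forall x : R, 0 < x -> {for x, continuous f}) ->
  integrable_near0 f -> f x @[x --> +oo] --> (0 : R) ->
  (@lebesgue_measure R).-integrable `]0, +oo[
    (EFin \o (fun y : R => gauss s (x - y) * f y)).
Proof.
move=> s0 cf f0 finf.
have i1 := integrable_gauss_weight (x / s ^+ 2) s0 cf f0 finf.
apply: eq_integrable (integrableZl _ (gauss s x) i1) => // y _ /=.
by rewrite -EFinM gaussB// !mulrA.
Qed.

Lemma continuous_gamma_kernel (R : realType) (q : nat) (s x y : R) :
  {for y, continuous (fun y : R => gamma_kernel q s (x - y))}.
Proof.
have cw : {for y, continuous (fun y : R => (x - y) / (q%:R * s))}.
  by apply: cvgMr_tmp; apply: cvgB; [exact: cvg_cst|exact: cvg_id].
apply: (@continuous_comp _ _ _ (fun y : R => Num.max 0 (1 + (x - y) / (q%:R * s)) *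
  expR (- ((x - y) / (q%:R * s)))) (fun v => v ^+ (q ^ 2))); last exact: exprn_continuous.
apply: cvgM.
  apply: (@continuous_max R R (fun=> 0) (fun y : R => 1 + (x - y) / (q%:R * s)));
    first exact: cvg_cst.
  by apply: cvgD; [exact: cvg_cst|exact: cw].
apply: (@continuous_comp _ _ _ (fun y : R => - ((x - y) / (q%:R * s))) expR);
  last exact: continuous_expR.
by apply: cvgN; exact: cw.
Qed.

Definition gamma_transform (R : realType) (q : nat) (s : R) (f : R -> R) (x : R) : R :=
  \int[@lebesgue_measure R]_(y in `]0, +oo[) (gamma_kernel q s (x - y) * f y).

(** A bound free of [q], for dominated convergence. For [x <= y] the logarithmic remainder is
    nonpositive; for [0 < y < x] the kernel is at most 1 and [(x - y) ^+ 2 <= x ^+ 2], which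
    dictates the constant. *)
Lemma gamma_kernel_dominated (R : realType) (q : nat) (s x y : R) :
  (0 < q)%N -> 0 < s -> 0 < y ->
  gamma_kernel q s (x - y) <= expR (x ^+ 2 / (s ^+ 2 *+ 2)) * gauss s (x - y).
Proof.
move=> q0 s0 y0; have c0 : 0 < s ^+ 2 *+ 2 by rewrite pmulrn_lgt0// exprn_gt0.
have [xy|yx] := leP x y.
  apply: le_trans (gamma_kernel_le_gauss q0 s0 _) _; first by rewrite subr_le0.
  rewrite ler_peMl ?gauss_ge0// -expR0 ler_expR divr_ge0 ?sqr_ge0//.
  exact: ltW.
apply: le_trans (gamma_kernel_le1 _ _ _) _.
rewrite /gauss -expRD -expR0 ler_expR -mulrDl divr_ge0 ?(ltW c0)//.
nra.
Qed.

Lemma gamma_kernel_dominated_norm (R : realType) (q : nat) (s x y : R) (f : R -> R) :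
  (0 < q)%N -> 0 < s -> 0 < y ->
  `|gamma_kernel q s (x - y) * f y| <=
  expR (x ^+ 2 / (s ^+ 2 *+ 2)) * `|gauss s (x - y) * f y|.
Proof.
move=> q0 s0 y0; rewrite !normrM mulrA ler_wpM2r// !ger0_norm ?gauss_ge0 ?gamma_kernel_ge0//.
exact: gamma_kernel_dominated.
Qed.

Lemma measurable_kernel_mul (R : realType) (k f : R -> R) :
  (forall y : R, {for y, continuous k}) ->
  (forall x : R, 0 < x -> {for x, continuous f}) ->
  measurable_fun (`]0, +oo[ : set (measurableTypeR R)) (fun y => k y * f y).
Proof.
move=> ck cf; apply: continuous_pos_measurable => y y0.
by apply: cvgM; [exact: ck|exact: cf].
Qed.

Lemma integrable_gamma_transform (R : realType) (q : nat) (s x : R) (f : R -> R) :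
  (0 < q)%N -> 0 < s -> (forall x : R, 0 < x -> {for x, continuous f}) ->
  integrable_near0 f -> f x @[x --> +oo] --> (0 : R) ->
  (@lebesgue_measure R).-integrable `]0, +oo[
    (EFin \o (fun y : R => gamma_kernel q s (x - y) * f y)).
Proof.
move=> q0 s0 cf f0 finf; have sn0 : s != 0 by rewrite gt_eqF.
have ig := integrable_gauss_transform x sn0 cf f0 finf.
apply: le_integrable (integrableZl _ (expR (x ^+ 2 / (s ^+ 2 *+ 2))) ig) => //.
  by apply/measurable_EFinP; apply: measurable_kernel_mul => // y; exact: continuous_gamma_kernel.
move=> y; rewrite /= in_itv/= andbT => y0.
rewrite lee_fin [leRHS]normrM [`|expR _|]ger0_norm ?expR_ge0//.
exact: gamma_kernel_dominated_norm.
Qed.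

Lemma cvg_gamma_transform (R : realType) (s x : R) (f : R -> R) :
  0 < s -> (forall x : R, 0 < x -> {for x, continuous f}) ->
  integrable_near0 f -> f x @[x --> +oo] --> (0 : R) ->
  gamma_transform q.+1 s f x @[q --> \oo] --> gauss_transform s f x.
Proof.
move=> s0 cf f0 finf; have sn0 : s != 0 by rewrite gt_eqF.
have ig := integrable_gauss_transform x sn0 cf f0 finf.
have [||||||_ _ h] := @dominated_convergence _ _ _ (@lebesgue_measure R) `]0, +oo[ _
    (fun q y => (gamma_kernel q.+1 s (x - y) * f y)%:E)
    (fun y => (gauss s (x - y) * f y)%:E)
    (fun y => (expR (x ^+ 2 / (s ^+ 2 *+ 2)))%:E * `|(gauss s (x - y) * f y)%:E|)%E.
- exact: measurable_itv.
- move=> q; apply/measurable_EFinP; apply: measurable_kernel_mul => // y.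
  exact: continuous_gamma_kernel.
- apply/measurable_EFinP; apply: measurable_kernel_mul => // y.
  exact: continuous_gauss.
- apply: aeW => y Dy; apply: cvg_EFin; first exact: nearW.
  by apply: cvgMr_tmp; exact: cvg_gamma_kernel.
- by apply: integrableZl => //; exact: integrable_abse ig.
- apply: aeW => y q; rewrite /= in_itv/= andbT => y0.
  by rewrite lee_fin gamma_kernel_dominated_norm.
apply: fine_cvg; rewrite /gauss_transform /Rintegral fineK//.
exact: integrable_fin_num.
Qed.

(** After the shift by [q * s], the distance to [y] is [q * s * (1 + (x - y) / (q * s))]; the factor
    [q * s] and the constant part of the exponent come out of the integral. *)
Lemma gamma_conv_transform (R : realType) (q : nat) (s x : R) (f : R -> R) :
  (0 < q)%N -> 0 < s -> (forall x : R, 0 < x -> {for x, continuous f}) ->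
  integrable_near0 f -> f x @[x --> +oo] --> (0 : R) ->
  gamma_conv (q ^ 2) (s / q%:R) f (x + q%:R * s) =
  ((q%:R * s) * expR (- 1)) ^+ (q ^ 2) * gamma_transform q s f x.
Proof.
move=> q0 s0 cf f0 finf; have qr0 : 0 < q%:R :> R by rewrite ltr0n.
have qs0 : 0 < q%:R * s by rewrite mulr_gt0.
have ig := integrable_gamma_transform x q0 s0 cf f0 finf.
set X := x + q%:R * s.
have sub : (`]0, X]%classic : set R) `<=` `]0, +oo[%classic.
  by move=> y /=; rewrite !in_itv/= andbT => /andP[].
(* The kernel vanishes for [y > X], thanks to its cut-off at 0. *)
have -> : gamma_transform q s f x =
    \int[@lebesgue_measure R]_(y in `]0, X]) (gamma_kernel q s (x - y) * f y).
  rewrite -[in RHS](setIidr sub) Rintegral_mkcondr; apply: eq_Rintegral => y.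
  rewrite inE/= in_itv/= andbT => y0; rewrite patchE; case: ifPn => //.
  rewrite notin_setE/= in_itv/= y0/= => /negP; rewrite -ltNge => Xy.
  by rewrite gamma_kernel_beyond ?mul0r//; move: Xy; rewrite /X; lra.
rewrite -RintegralZl//; last exact: integrableS ig.
apply: eq_Rintegral => y; rewrite inE/= in_itv/= => /andP[y0 yX].
rewrite mulrA; congr (_ * _).
rewrite /gamma_kernel -exprMn.
have -> : Num.max 0 (1 + (x - y) / (q%:R * s)) = (X - y) / (q%:R * s).
  rewrite (_ : 1 + _ = (X - y) / (q%:R * s)); last by rewrite /X; field; rewrite !gt_eqF.
  by apply/max_idPr; rewrite divr_ge0 ?subr_ge0// ltW.
have -> : - (s / q%:R)^-1 * (X - y) = (q ^ 2)%:R * (- 1 - (x - y) / (q%:R * s)).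
  by rewrite natrX /X; field; rewrite !gt_eqF.
rewrite expRM_natl expRD -exprMn; congr (_ ^+ _).
by field; rewrite !gt_eqF.
Qed.

(** * Measures with a density *)

Section DensityMeasure.
Context {d} {T : measurableType d} {R : realType}.
Variables (mu : {measure set T -> \bar R}) (f : T -> R).
Hypotheses (f0 : forall x, 0 <= f x) (mf : measurable_fun setT f).
Local Open Scope ereal_scope.

(** The proofs are arguments so that the measure structure can be attached to the function
    itself. *)
Definition density_measure of (forall x, (0 <= f x)%R) & measurable_fun setT f :=
  fun A : set T => \int[mu]_(x in A) (f x)%:E.

Local Notation nu := (density_measure f0 mf).

Let nu0 : nu set0 = 0.
Proof. by rewrite /density_measure integral_set0. Qed.

Let nu_ge0 A : 0 <= nu A.
Proof. by apply: integral_ge0 => x _; rewrite lee_fin. Qed.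

Let nu_sigma_additive : semi_sigma_additive nu.
Proof.
move=> F mF tF mUF; rewrite /density_measure ge0_integral_bigcup//.
- by apply: is_cvg_ereal_nneg_natsum_cond => n _ _; exact: nu_ge0.
- exact/measurable_EFinP/measurable_funTS.
- by move=> x _; rewrite lee_fin.
Qed.

HB.instance Definition _ := isMeasure.Build _ _ _ nu nu0 nu_ge0 nu_sigma_additive.

Import HBNNSimple.

(** Monotone convergence along simple approximations of [h] on both sides, then linearity, reduce
    the identity to indicators, where it is the definition of the measure. *)
Lemma ge0_integral_density (h : T -> \bar R) :
  measurable_fun setT h -> (forall x, 0 <= h x) ->
  \int[nu]_x h x = \int[mu]_x (h x * (f x)%:E).
Proof.
move=> mh h0; pose h_ := nnsfun_approx measurableT mh.
have mEf : measurable_fun setT (EFin \o f) by exact/measurable_EFinP.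
have -> : \int[nu]_x h x = lim (\int[nu]_x (EFin \o h_ n) x @[n --> \oo]).
  have hE x : h x = lim ((EFin \o h_ n) x @[n --> \oo]).
    by apply/esym/cvg_lim => //; exact: cvg_nnsfun_approx.
  under eq_integral do rewrite hE.
  apply: monotone_convergence => //.
  - by move=> n; exact/measurable_EFinP/measurable_funP.
  - by move=> n x _ /=; rewrite lee_fin.
  - by move=> x _ a b ab; rewrite lee_fin; exact/lefP/nd_nnsfun_approx.
have -> : \int[mu]_x (h x * (f x)%:E) =
    lim (\int[mu]_x ((EFin \o h_ n) x * (f x)%:E) @[n --> \oo]).
  have hfE x : h x * (f x)%:E = lim ((EFin \o h_ n) x * (f x)%:E @[n --> \oo]).
    by apply/esym/cvg_lim => //; apply: cvgeZr => //; exact: cvg_nnsfun_approx.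
  under eq_integral do rewrite hfE.
  apply: monotone_convergence => //.
  - by move=> n; apply: emeasurable_funM => //; exact/measurable_EFinP/measurable_funP.
  - by move=> n x _ /=; rewrite mule_ge0 ?lee_fin.
  - move=> x _ a b ab /=; rewrite lee_wpmul2r ?lee_fin//.
    exact/lefP/nd_nnsfun_approx.
suff suf n : \int[mu]_x ((EFin \o h_ n) x * (f x)%:E) = \int[nu]_x (EFin \o h_ n) x.
  by under [in RHS]eq_fun do rewrite suf.
transitivity (\int[nu]_x
   (\sum_(y \in range (h_ n)) (y * \1_(h_ n @^-1` [set y]) x)%:E)); last first.
  by apply: eq_integral => t _; rewrite /= fimfunE -fsumEFin.
have indich m r : measurable_fun setT (fun x => (r * \1_(h_ m @^-1` [set r]) x)%:E).
  by apply: (measurable_comp measurableT) => //; exact: measurable_funM.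
rewrite ge0_integral_fsum//; last by move=> m y Ey; exact: nnfun_muleindic_ge0.
transitivity (\int[mu]_x (\sum_(y \in range (h_ n))
    (y * \1_(h_ n @^-1` [set y]) x)%:E * (f x)%:E)).
  under [RHS]eq_integral => x xE.
    rewrite -ge0_mule_fsuml => [|y]; last exact: nnfun_muleindic_ge0.
    rewrite fsumEFin // -(fimfunE _ x); over.
  by [].
rewrite ge0_integral_fsum//; last 2 first.
  - by move=> y; apply: emeasurable_funM.
  - by move=> m y _; apply: mule_ge0; [exact: nnfun_muleindic_ge0|rewrite lee_fin].
apply: eq_fsbigr => r rhn.
under [RHS]eq_integral do rewrite EFinM.
rewrite integralZl_indic_nnsfun => //.
under eq_integral do rewrite EFinM -muleA.
rewrite ge0_integralZl//.
- under eq_integral do rewrite muleC.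
  rewrite (eq_integral ((EFin \o f) \_ (h_ n @^-1` [set r]))); last first.
    by move=> x xE; rewrite epatch_indic.
  by rewrite -integral_mkcond integral_indic// setIT.
- by apply: emeasurable_funM => //; exact/measurable_EFinP.
- by move=> t _; rewrite mule_ge0 ?lee_fin.
- by move: rhn; rewrite inE => -[t _ <-]; rewrite lee_fin.
Qed.

End DensityMeasure.

(** * Gaussian transforms *)

Definition laplace_integrable (R : realType) (w : R -> R) : Prop :=
  forall a : R, (@lebesgue_measure R).-integrable `]0, +oo[
    (EFin \o (fun y : R => expR (a * y) * w y)).

(** The factor [c * y] is at most [expR (c * y)], so it only shifts the exponent. *)
Lemma laplace_integrable_mulX (R : realType) (c : R) (w : R -> R) :
  0 < c -> laplace_integrable w -> laplace_integrable (fun y => c * y * w y).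
Proof.
move=> c0 iw a; apply: le_integrable (iw (a + c)) => //.
  have /measurable_EFinP mw := measurable_int _ (iw a).
  apply/measurable_EFinP.
  apply: (@eq_measurable_fun _ _ _ _ _ (fun y : R => c * y * (expR (a * y) * w y))).
    by move=> y _ /=; ring.
  by apply: measurable_funM => //; apply: measurable_funM.
move=> y; rewrite /= in_itv/= andbT => y0; rewrite lee_fin.
rewrite mulrDl expRD (mulrA _ _ (w y)) !normrM ler_wpM2r// ler_wpM2l//.
rewrite -normrM ger0_norm ?mulr_ge0 ?(ltW c0) ?(ltW y0)// ger0_norm ?expR_ge0//.
by apply: le_trans (expR_ge1Dx _); rewrite lerDr.
Qed.

Definition laplace (R : realType) (c : R) (w : R -> R) (x : R) : R :=
  \int[@lebesgue_measure R]_(y in `]0, +oo[) (expR (c * x * y) * w y).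

Lemma is_derive_laplace (R : realType) (c x : R) (w : R -> R) :
  0 < c -> laplace_integrable w ->
  is_derive x 1 (laplace c w) (laplace c (fun y => c * y * w y) x).
Proof.
move=> c0 iw; have iw' := laplace_integrable_mulX c0 iw.
pose F (z y : R) : R := expR (c * z * y) * w y.
have dF (z y : R) : is_derive z 1 (F ^~ y) (expR (c * z * y) * (c * y * w y)).
  have h1 := is_derive_expR_mul (c * y) (is_derive_cst (w y) z 1).
  have -> : F ^~ y = (fun z => expR (c * y * z) * (cst (w y) : R -> R) z).
    by apply/funext => v; rewrite /F/=; congr (expR _ * _); ring.
  by apply: is_derive_eq h1 _ => /=; rewrite addr0; congr (expR _ * _); ring.
have dE z y : partial1of2 F z y = expR (c * z * y) * (c * y * w y).
  by rewrite partial1of2E; have h := dF z y; rewrite (@derive_val _ _ _ _ _ _ _ h).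
(* The integrand of the derivative at the right end of []x - 1, x + 1[] dominates all others, since
   [y > 0]. *)
pose G (y : R) := `|expR (c * (x + 1) * y) * (c * y * w y)|.
have Ix : (`]x - 1, x + 1[%classic : set R) x.
  by rewrite /= in_itv/= ltrBlDr ltrDl ltr01.
have iF z : (`]x - 1, x + 1[%classic : set R) z ->
    (@lebesgue_measure R).-integrable `]0, +oo[ (EFin \o F z).
  by move=> _; exact: iw.
have dF' z y : (`]x - 1, x + 1[%classic : set R) z ->
    (`]0, +oo[%classic : set R) y -> derivable (F ^~ y) z 1.
  by move=> _ _; have [] := dF z y.
have G0 y : 0 <= G y by exact: normr_ge0.
have iG : (@lebesgue_measure R).-integrable `]0, +oo[ (EFin \o G).
  exact: integrable_norm (iw' _).
have Gub z y : (`]x - 1, x + 1[%classic : set R) z ->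
    (`]0, +oo[%classic : set R) y -> `|partial1of2 F z y| <= G y.
  rewrite /= !in_itv/= andbT => /andP[_ zx] y0.
  rewrite dE /G !normrM ler_wpM2r// !ger0_norm ?expR_ge0// ler_expR ler_pM2r//.
  by rewrite ler_pM2l// ltW.
apply: DeriveDef.
  exact: (derivable_under_integral _ Ix iF dF' G0 iG Gub).
rewrite -derive1E.
rewrite (differentiation_under_integral _ Ix iF dF' G0 iG Gub)//.
by apply: eq_Rintegral => y _ /=; rewrite dE.
Qed.

Lemma laplace_family (R : realType) (c : R) (w : R -> R) :
  0 < c -> laplace_integrable w ->
  exists2 D : nat -> R -> R, der_family setT D & D 0 = laplace c w.
Proof.
move=> c0 iw; pose wn := fix wn n (y : R) := if n is n'.+1 then c * y * wn n' y else w y.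
exists (fun n => laplace c (wn n)) => // n x _.
apply: is_derive_laplace => //; elim: n => [|n IH]; first exact: iw.
exact: laplace_integrable_mulX.
Qed.

(** The derivatives are given by the Hermite three-term recurrence. It involves two earlier orders,
    so two consecutive derivative statements are proved together. *)
Lemma gauss_family (R : realType) (s : R) : s != 0 ->
  exists2 D : nat -> R -> R, der_family setT D & D 0 = gauss s.
Proof.
move=> s0; pose k := - s ^- 2.
have [D [D0 D1 DS]] : exists D : nat -> R -> R, [/\ D 0 = gauss s,
    D 1 = (fun x => k * (x * D 0 x)) &
    forall n, D n.+2 = (fun x => k * (x * D n.+1 x + n.+1%:R * D n x))].
  pose D := fix D n (x : R) := match n with
    | 0 => gauss s x
    | n1.+1 => match n1 with
      | 0 => k * (x * gauss s x)
      | n2.+1 => k * (x * D n1 x + n1%:R * D n2 x)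
      end
    end.
  by exists D.
exists D => // n x _.
suff [h _] : is_derive x 1 (D n) (D n.+1 x) /\ is_derive x 1 (D n.+1) (D n.+2 x) by [].
elim: n => [|n [IH0 IH1]].
  have h0 : is_derive x 1 (D 0) (D 1 x).
    rewrite D1 D0 /gauss.
    have h1 := is_deriveM (is_derive_id x (1 : R)) (is_derive_id x (1 : R)).
    have h2 := is_deriveM h1 (is_derive_cst (k / 2) x 1).
    have h3 := @is_derive1_comp _ expR _ x _ _ (is_derive_expR _) h2.
    have -> : (fun z : R => expR (- z ^+ 2 / (s ^+ 2 *+ 2))) =
        expR \o (id * id * cst (k / 2)).
      by apply/funext => z /=; congr expR; rewrite /k !fctE; field.
    apply: is_derive_eq h3 _; rewrite /GRing.scale/= !fctE.
    have -> : x * x * (k / 2) = - x ^+ 2 / (s ^+ 2 *+ 2) by rewrite /k; field.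
    by field.
  split => //; rewrite DS D1.
  have h1 := is_deriveM (is_derive_cst k x 1) (is_deriveM (is_derive_id x (1 : R)) h0).
  by apply: is_derive_eq h1 _; rewrite /GRing.scale/= D1; ring.
split => //; rewrite (DS n.+1) (DS n).
have h1 := is_deriveM (is_derive_cst (n.+1%:R : R) x 1) IH0.
have h2 := is_deriveD (is_deriveM (is_derive_id x (1 : R)) IH1) h1.
have h3 := is_deriveM (is_derive_cst k x 1) h2.
apply: is_derive_eq h3 _; rewrite /GRing.scale/= (DS n) -(natr1 n.+1).
by ring.
Qed.

(** Leibniz' rule with a list of index pairs: repeated pairs take the place of binomial
    coefficients. *)
Lemma der_family_mul (R : realType) (I : set R) (A B : nat -> R -> R) :
  der_family I A -> der_family I B ->
  exists2 D : nat -> R -> R, der_family I D & D 0 = fun x => A 0 x * B 0 x.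
Proof.
move=> dA dB.
pose next (l : seq (nat * nat)) := flatten [seq [:: (p.1.+1, p.2); (p.1, p.2.+1)] | p <- l].
pose val (l : seq (nat * nat)) (x : R) := \sum_(p <- l) A p.1 x * B p.2 x.
exists (fun n => val (iter n next [:: (0%N, 0%N)])); last first.
  by apply/funext => x; rewrite /val/= big_seq1.
move=> n x Ix; rewrite iterS; elim: (iter n next _) => [|[i j] l IH].
  rewrite /val/= big_nil (_ : (fun x => _) = cst 0); last first.
    by apply/funext => z; rewrite big_nil.
  exact: is_derive_cst.
have -> : val ((i, j) :: l) = fun z => A i z * B j z + val l z.
  by apply/funext => z; rewrite /val big_cons.
have h1 := is_deriveD (is_deriveM (dA i x Ix) (dB j x Ix)) IH.
apply: is_derive_eq h1 _.
by rewrite /val /next/= !big_cons/= /GRing.scale/=; ring.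
Qed.

Lemma gauss_transformE (R : realType) (s : R) (f : R -> R) :
  s != 0 -> (forall x : R, 0 < x -> {for x, continuous f}) ->
  integrable_near0 f -> f x @[x --> +oo] --> (0 : R) ->
  gauss_transform s f =
  fun x => gauss s x * laplace (s ^- 2) (fun y => gauss s y * f y) x.
Proof.
move=> s0 cf f0 finf; apply/funext => x.
rewrite /gauss_transform /laplace -RintegralZl//; last exact: integrable_gauss_weight.
apply: eq_Rintegral => y _; rewrite gaussB//.
by rewrite [x / _]mulrC -!mulrA.
Qed.

Lemma gauss_transform_family (R : realType) (s : R) (f : R -> R) :
  s != 0 -> (forall x : R, 0 < x -> {for x, continuous f}) ->
  integrable_near0 f -> f x @[x --> +oo] --> (0 : R) ->
  exists2 D : nat -> R -> R, der_family setT D & D 0 = gauss_transform s f.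
Proof.
move=> s0 cf f0 finf.
have [A dA A0] := gauss_family s0.
have c0 : 0 < s ^- 2 by rewrite invr_gt0 exprn_even_gt0.
have [B dB B0] := laplace_family c0 (fun a => integrable_gauss_weight a s0 cf f0 finf).
have [D dD D0] := der_family_mul dA dB.
by exists D => //; rewrite D0 A0 B0 gauss_transformE.
Qed.

(** On [[1, 2]] the continuous integrand has a positive minimum, which bounds the integral from
    below. *)
Lemma gauss_transform_gt0 (R : realType) (s x : R) (f : R -> R) :
  s != 0 -> (forall x : R, 0 < x -> {for x, continuous f}) ->
  integrable_near0 f -> f x @[x --> +oo] --> (0 : R) ->
  (forall y, 0 < y -> 0 < f y) -> 0 < gauss_transform s f x.
Proof.
move=> s0 cf f0 finf fpos.
have ig := integrable_gauss_transform x s0 cf f0 finf.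
pose w (y : R) := gauss s (x - y) * f y.
have cw (y : R) : 0 < y -> {for y, continuous w}.
  by move=> y0; apply: cvgM; [exact: continuous_gauss|exact: cf].
have w0 y : 0 < y -> 0 < w y by move=> y0; rewrite mulr_gt0 ?expR_gt0 ?fpos.
have [|c c12 wc] := @EVT_min R w 1 2 (ler1n _ 2) _.
  apply: continuous_in_subspaceT => y; rewrite inE/= in_itv/= => /andP[y1 _].
  by apply: cw; exact: lt_le_trans y1.
have c0 : 0 < c by move: c12; rewrite in_itv/= => /andP[/(lt_le_trans ltr01)].
apply: lt_le_trans (w0 c c0) _.
have sub : (`[1, 2]%classic : set R) `<=` `]0, +oo[%classic.
  by move=> y /=; rewrite !in_itv/= andbT => /andP[/(lt_le_trans ltr01)].
rewrite -lee_fin /gauss_transform /Rintegral fineK ?integrable_fin_num//.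
apply: (@le_trans _ _ (\int[@lebesgue_measure R]_(y in `[1%R, 2%R]) (w y)%:E)%E); last first.
  apply: ge0_subset_integral => //.
    by have := measurable_int _ ig.
  by move=> y; rewrite /= in_itv/= andbT => /w0/ltW; rewrite lee_fin.
apply: (@le_trans _ _ (\int[@lebesgue_measure R]_(y in `[1%R, 2%R]) (cst (w c)%:E) y)%E).
  rewrite integral_cst//= lebesgue_measure_itv/= lte_fin ltr1n/= -EFinD.
  by rewrite -EFinM lee_fin; have := ltW (w0 c c0); nra.
apply: ge0_le_integral => //.
- by move=> y _; rewrite lee_fin (ltW (w0 _ c0)).
- exact: measurable_funS (measurable_int _ ig).
Qed.

Lemma cvg_gauss_pinfty (R : realType) (s a : R) : s != 0 ->
  gauss s (x - a) @[x --> +oo] --> (0 : R).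
Proof.
move=> s0; have c0 : 0 < (s ^+ 2 *+ 2)^-1.
  by rewrite invr_gt0 pmulrn_lgt0// exprn_even_gt0.
have h1 : (s ^+ 2 *+ 2)^-1 * (x - a) ^+ 2 @[x --> +oo] --> (+oo : set_system R).
  apply: gt0_cvgMry => //; apply: (cvg_comp (fun x => x - a) (fun x => x ^+ 2)) cvgr_expr2.
  exact: cvg_addrr.
have := cvg_comp _ _ h1 (@cvgr_expR R); apply: cvg_trans; apply: near_eq_cvg.
by apply: nearW => x /=; rewrite /gauss; congr expR; ring.
Qed.

Lemma cvg_gauss_ninfty (R : realType) (s : R) : s != 0 ->
  gauss s x @[x --> -oo] --> (0 : R).
Proof.
move=> s0; apply/cvgNy_compNP; have := cvg_gauss_pinfty 0 s0.
by under eq_fun do rewrite subr0 -gaussN.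
Qed.

(** For [x <= 0] the Laplace factor is at most its value at 0, and the Gaussian factor tends to
    zero. *)
Lemma gauss_transform_cvg_ninfty (R : realType) (s : R) (f : R -> R) :
  s != 0 -> (forall x : R, 0 < x -> {for x, continuous f}) ->
  integrable_near0 f -> f x @[x --> +oo] --> (0 : R) ->
  (forall y, 0 < y -> 0 < f y) ->
  gauss_transform s f x @[x --> -oo] --> (0 : R).
Proof.
move=> s0 cf f0 finf fpos.
have lim : laplace (s ^- 2) (fun y => gauss s y * f y) 0 * gauss s x @[x --> -oo] --> (0 : R).
  by apply: cvg0M; exact: cvg_gauss_ninfty.
have sq : \forall x \near -oo, 0 <= gauss_transform s f x <=
    laplace (s ^- 2) (fun y => gauss s y * f y) 0 * gauss s x.
  near=> x; rewrite ltW ?gauss_transform_gt0//= gauss_transformE// mulrC.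
  rewrite ler_wpM2r ?gauss_ge0//; apply: le_Rintegral => //.
  - exact: integrable_gauss_weight.
  - exact: integrable_gauss_weight.
  move=> y; rewrite /= in_itv/= andbT => y0.
  have x0 : x <= 0 by near: x; apply: nbhs_ninfty_le; exact: num_real.
  rewrite ler_wpM2r ?mulr_ge0 ?gauss_ge0 ?(ltW (fpos _ y0))//.
  rewrite ler_expR ler_wpM2r ?(ltW y0)// ler_wpM2l// invr_ge0.
  by rewrite exprn_even_ge0.
by apply: (squeeze_cvgr sq) => //; exact: cvg_cst.
Unshelve. all: by end_near. Qed.

(** Split at [X]: on []0, X]] the Gaussian is at most [gauss s (x - X)], and beyond [X] the small
    bound on [f] is integrated against a Gaussian of total mass [p^-1]. *)
Lemma gauss_transform_cvg_pinfty (R : realType) (s : R) (f : R -> R) :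
  s != 0 -> (forall x : R, 0 < x -> {for x, continuous f}) ->
  integrable_near0 f -> f x @[x --> +oo] --> (0 : R) ->
  (forall y, 0 < y -> 0 < f y) ->
  gauss_transform s f x @[x --> +oo] --> (0 : R).
Proof.
move=> s0 cf f0 finf fpos; apply/cvgr0Pnorm_lt => e e0.
pose p := normal_peak s; have p0 : 0 < p by exact: normal_peak_gt0.
have e20 : 0 < e / 2 by rewrite divr_gt0.
have pe0 : 0 < p * (e / 2) by rewrite mulr_gt0.
have := finf; move=> /cvgr0_norm_lt/(_ _ pe0)[M [_ fM]].
pose X := Num.max M 1; have X0 : 0 < X by rewrite lt_max ltr01 orbT.
have fX y : X < y -> f y < p * (e / 2).
  move=> Xy; apply: le_lt_trans (ler_norm _) (fM _ _).
  by apply: le_lt_trans Xy; rewrite le_max lexx.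
have iX := integrable_near0_itv X cf f0.
have if1 : (@lebesgue_measure R).-integrable setT (EFin \o (f \_ `]0, X])).
  by rewrite -restrict_EFin; apply/integrable_restrict => //; rewrite setTI.
pose C := \int[@lebesgue_measure R]_y (f \_ `]0, X]) y.
have bound x : X < x -> gauss_transform s f x <= gauss s (x - X) * C + e / 2.
  move=> Xx.
  have -> : e / 2 = p * (e / 2) * \int[@lebesgue_measure R]_y gauss s (x - y).
    by rewrite Rintegral_gauss// -/p; field; rewrite gt_eqF.
  rewrite /C -!RintegralZl//; last exact: integrable_gauss.
  have i1 : (@lebesgue_measure R).-integrable setT
      (EFin \o (fun y => gauss s (x - X) * (f \_ `]0, X]) y)).
    by have := integrableZl measurableT (gauss s (x - X)) if1; apply.
  have i2 : (@lebesgue_measure R).-integrable setT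
      (EFin \o (fun y => p * (e / 2) * gauss s (x - y))).
    by have := integrableZl measurableT (p * (e / 2)) (integrable_gauss x s0); apply.
  rewrite -RintegralD//.
  rewrite /gauss_transform Rintegral_mkcond; apply: le_Rintegral => //.
  - rewrite -restrict_EFin; apply/integrable_restrict => //; rewrite setTI.
    exact: integrable_gauss_transform.
  - exact: integrableD i1 i2.
  move=> y _; rewrite !patchE !mem_setE !in_itv/= andbT.
  have [y0|y0] /= := ltP 0 y; last first.
    by rewrite mulr0 add0r mulr_ge0 ?gauss_ge0// ltW.
  have [yX|Xy] := leP y X.
    apply: (@le_trans _ _ (gauss s (x - X) * f y)); last first.
      by rewrite lerDl mulr_ge0 ?gauss_ge0// ltW.
    rewrite ler_wpM2r ?(ltW (fpos _ y0))// ler_expR ler_wpM2r//.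
      by rewrite invr_ge0 mulrn_wge0// sqr_ge0.
    by rewrite lerN2 lerXn2r ?nnegrE; lra.
  rewrite mulr0 add0r mulrC ler_wpM2r ?gauss_ge0// ltW//.
  exact: fX.
near=> x.
have Xx : X < x by near: x; apply: nbhs_pinfty_gt; exact: num_real.
rewrite ger0_norm ?(ltW (gauss_transform_gt0 _ _ _ _ _ _))//.
apply: le_lt_trans (bound x Xx) _.
have : `|C * gauss s (x - X)| < e / 2.
  near: x; apply: cvgr0_norm_lt => //.
  by apply: cvg0M; exact: cvg_gauss_pinfty.
by move=> /(le_lt_trans (ler_norm _)); rewrite mulrC; lra.
Unshelve. all: by end_near. Qed.

(** * Bell shape of the Gaussian transform *)

Lemma fin_diff_affine (R : realType) (u v : R -> R) (k a d : R) n x :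
  (forall x, u x = k * v (x + a)) ->
  fin_diff n d u x = k * fin_diff n d v (x + a).
Proof.
by move=> uv; elim: n x => [|n IH] x /=; rewrite ?uv// !IH -mulrBr addrAC.
Qed.

Lemma filter_forall_le (T : Type) (F : set_system T) {FF : Filter F} (N : nat)
    (P : nat -> T -> Prop) :
  (forall j, (j <= N)%N -> \forall t \near F, P j t) ->
  \forall t \near F, forall j, (j <= N)%N -> P j t.
Proof.
move=> FP; have : \forall t \near F, forall j : 'I_N.+1, P j t.
  by apply: filter_forall => j; apply: FP; rewrite -ltnS.
by apply: filterS => t Pt j jN; exact: (Pt (Ordinal (jN : (j < N.+1)%N))).
Qed.

(** For small [d], [D n] keeps its sign on each window from [x j] to [x j + d *+ n], so the
    differences inherit the signs. The windows are also disjoint: points picked from them by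
    [fin_diff_mvt] for another family stay in order. *)
Lemma alternates_fin_diff (R : realType) (D : nat -> R -> R) n N t :
  der_family setT D -> alternates setT (D n) N t ->
  exists2 d : R, 0 < d & exists x : nat -> R,
    (forall j, (j < N)%N -> x j + d *+ n < x j.+1) /\
    (forall j, (j <= N)%N -> 0 < t * (-1) ^+ j * fin_diff n d (D 0) (x j)).
Proof.
move=> dD [x [_ ltx sx]].
have upT : upclosed (setT : set R) by [].
have near1 : \forall d \near (0 : R)^'+, forall j, (j <= N)%N ->
    (j < N)%N -> x j + d *+ n < x j.+1.
  apply: filter_forall_le => j _; case: (ltnP j N) => [jN|_]; last exact: nearW.
  (* The divisor [n.+1] covers [n = 0] as well. *)
  have gap : 0 < (x j.+1 - x j) / n.+1%:R by rewrite divr_gt0 ?subr_gt0 ?ltx.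
  near=> d => _; rewrite addrC -ltrBrDr -mulr_natr.
  have d0 : 0 < d by near: d; exact: nbhs_right_gt.
  apply: (@le_lt_trans _ _ (d * n.+1%:R)); first by rewrite ler_pM2l// ler_nat.
  by rewrite -ltr_pdivlMr//; near: d; exact: nbhs_right_lt.
have near2 : \forall d \near (0 : R)^'+, forall j, (j <= N)%N ->
    forall z, x j <= z -> z <= x j + d *+ n -> 0 < t * (-1) ^+ j * D n z.
  apply: filter_forall_le => j jN.
  have cD : {for x j, continuous (fun z => t * (-1) ^+ j * D n z)}.
    by apply: cvgMl_tmp; have h := dD n (x j) I; exact: is_derive_continuous h.
  have /(cvgr_gt _ cD) := sx j jN.
  move=> /nbhs_ballP[e /= e0 he].
  near=> d => z xz zx; apply: he.
  rewrite /ball/= ltr_distlC; apply/andP; split.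
    by apply: lt_le_trans xz; rewrite ltrBlDr ltrDl.
  apply: le_lt_trans zx _; rewrite ltrD2l -mulr_natr.
  have d0 : 0 < d by near: d; exact: nbhs_right_gt.
  apply: (@le_lt_trans _ _ (d * n.+1%:R)); first by rewrite ler_pM2l// ler_nat.
  rewrite -ltr_pdivlMr//; near: d; apply: nbhs_right_lt; exact: divr_gt0.
near (0 : R)^'+ => d.
have d0 : 0 < d by near: d; exact: nbhs_right_gt.
exists d => //; exists x; split=> [j jN|j jN].
  have := near near1 d; apply => //; exact: ltnW.
have [z [xz zx ->]] := fin_diff_mvt n upT dD (I : setT (x j)) d0.
rewrite mulrCA mulr_gt0 ?exprn_gt0//.
have := near near2 d; apply => //.
Unshelve. all: by end_near. Qed.

(* [gauss_transform s f] is the pointwise limit of shifts of whale-shaped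
   functions, and finite differences carry the sign changes to the limit. *)
Lemma gauss_transform_upper (R : realType) m (W D : nat -> R -> R) (s : R) n t :
  0 < s -> whale_family m W -> integrable_near0 (W 0) ->
  der_family setT D -> D 0 = gauss_transform s (W 0) ->
  ~ alternates setT (D n) n.+1 t.
Proof.
move=> s0 WW iW dD D0 /(alternates_fin_diff dD)[d d0 [x [ltx sx]]].
have [dW _ Winf _ _] := WW.
have cW y : 0 < y -> {for y, continuous (W 0)} by exact: der_family_continuous.
have near1 : \forall q \near \oo, forall j, (j <= n.+1)%N ->
    0 < t * (-1) ^+ j * fin_diff n d (gamma_transform q.+1 s (W 0)) (x j).
  apply: filter_forall_le => j jn.
  apply: (@cvgr_gt _ _ _ _ _ (t * (-1) ^+ j * fin_diff n d (D 0) (x j))); last exact: sx.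
  apply: cvgMl_tmp; rewrite D0; apply: cvg_fin_diff => y.
  exact: cvg_gamma_transform.
(* The shift by [q.+1 * s] brings all sample points into the half-line where the whale-shaped
   functions live. *)
have near2 : \forall q \near \oo, 0 < x 0%N + q.+1%:R * s.
  exists (Num.trunc (- x 0%N / s)) => // q /= hq.
  rewrite -ltrBlDl sub0r -ltr_pdivrMr//; apply: lt_le_trans (truncnS_gt _) _.
  by rewrite ler_nat ltnS.
have near3 : \forall q \near \oo, (n <= q)%N by exact: nbhs_infty_ge.
near \oo => q.
have qpos : 0 < x 0%N + q.+1%:R * s by near: q.
have nq : (n <= q)%N by near: q.
have qsgn : forall j, (j <= n.+1)%N ->
    0 < t * (-1) ^+ j * fin_diff n d (gamma_transform q.+1 s (W 0)) (x j) by near: q.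
have q0 : (0 < q.+1)%N by [].
have qr0 : 0 < q.+1%:R :> R by rewrite ltr0n.
have b0 : 0 < s / q.+1%:R by rewrite divr_gt0.
have [k k0 [E WE E0]] := whale_family_gamma_conv (q.+1 ^ 2) b0 WW iW.
have [dE _ _ _ _] := WE.
set a := q.+1%:R * s.
pose K := k * (q.+1%:R * s * expR (- 1)) ^+ (q.+1 ^ 2).
have K0 : 0 < K by rewrite mulr_gt0// exprn_gt0// !mulr_gt0 ?expR_gt0.
have GE y : gamma_transform q.+1 s (W 0) y = K^-1 * E 0 (y + a).
  rewrite E0 gamma_conv_transform// /K; field.
  by rewrite gt_eqF ?exprn_gt0 ?mulr_gt0 ?expR_gt0// gt_eqF.
have xpos j : (j <= n.+1)%N -> 0 < x j + a.
  elim: j => [_|j IH jn]; first exact: qpos.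
  apply: lt_trans (IH (ltnW jn)) _; rewrite ltrD2r.
  by apply: le_lt_trans (ltx j jn); rewrite lerDl mulrn_wge0// ltW.
have /choice[z zP] : forall j, exists z, (j <= n.+1)%N ->
    [/\ x j + a <= z, z <= x j + a + d *+ n & 0 < t * (-1) ^+ j * E n z].
  move=> j; have [jn|_] := leqP j n.+1; last by exists 0.
  have Ix : `]0, +oo[%classic (x j + a) by rewrite pos_itv xpos.
  have [z [xz zx Ez]] := fin_diff_mvt n (@upclosed_pos R) dE Ix d0.
  exists z => _; split => //.
  have := qsgn j jn; rewrite (fin_diff_affine _ _ _ GE) Ez.
  have -> : t * (-1) ^+ j * (K^-1 * (d ^+ n * E n z)) =
      K^-1 * d ^+ n * (t * (-1) ^+ j * E n z) by ring.
  by rewrite pmulr_rgt0// mulr_gt0 ?invr_gt0 ?exprn_gt0//; apply.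
(* The order of [E] is at least [n], so its [n]-th derivative obeys the bound [n], independent of
   [q]. *)
have nM : (n <= (m + q.+1 ^ 2).+1)%N.
  rewrite (leq_trans nq)// leqW// (leq_trans _ (leq_addl _ _))//.
  by rewrite (leq_trans (leqnSn q))// expnS leq_pmulr// expn_gt0.
have := @whale_family_upper _ _ _ n t WE; rewrite (minn_idPl nM); apply.
exists z; split => j jn.
- have [xz _ _] := zP j jn; rewrite pos_itv.
  exact: lt_le_trans (xpos j jn) xz.
- have [_ zx _] := zP j (ltnW jn); have [xz _ _] := zP j.+1 jn.
  apply: le_lt_trans zx (lt_le_trans _ xz).
  by rewrite addrAC ltrD2r ltx.
- by have [] := zP j jn.
Unshelve. all: by end_near. Qed.

Lemma strictly_bell_shaped_family (R : realType) (D : nat -> R -> R) :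
  der_family setT D -> (forall x, 0 < D 0 x) ->
  D 0 x @[x --> +oo] --> (0 : R) -> D 0 x @[x --> -oo] --> (0 : R) ->
  (forall n s, ~ alternates setT (D n) n.+1 s) ->
  strictly_bell_shaped (D 0).
Proof.
move=> dD D0 Dp Dn nalt.
have upT : upclosed (setT : set R) by [].
have dE n x : derive1n n (D 0) x = D n x.
  by apply: (der_family_derive1n openT dD).
split => //.
- by move=> x; exact: ltW.
- exact: (der_family_smooth_on openT dD).
move=> n; have -> : derive1n n (D 0) = D n by apply/funext => x; exact: dE.
split=> [|M].
  suff [s] : exists s, alternates setT (D n) n s by exact: alternates_sign.
  exists 1; elim: n => [|n IH].
    exists (fun=> 0); split => // -[|//] _.
    by rewrite expr0 !mul1r.
  apply: rolle_alternates_both IH; [exact: upT|exact: dD| |].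
  - exact: vanishes_left_family.
  - exact: vanishes_right_family.
rewrite leqNgt => alt; apply/negP => Mn.
have [s] := sign_alternates_alternates (sign_alternates_le Mn alt).
exact: nalt.
Qed.

Lemma conv_gauss_density (R : realType) (t x : R) (f : R -> R)
    (f0 : forall x, 0 <= (if 0 < x then f x else 0))
    (mf : measurable_fun (setT : set (measurableTypeR R)) (fun x => if 0 < x then f x else 0)) :
  0 < t -> (forall x : R, 0 < x -> {for x, continuous f}) ->
  integrable_near0 f -> f x @[x --> +oo] --> (0 : R) ->
  conv_gauss (density_measure (@lebesgue_measure R) f0 mf) t x =
  ((Num.sqrt (4 * pi * t))^-1 * gauss_transform (Num.sqrt (2 * t)) f x)%:E.
Proof.
move=> t0 cf if0 finf.
(* The heat kernel at time [t] is Gaussian with variance [2 * t]. *)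
set s := Num.sqrt (2 * t); set k := (Num.sqrt (4 * pi * t))^-1.
have s0 : s != 0 by rewrite gt_eqF// sqrtr_gt0 mulr_gt0.
have s2 : s ^+ 2 *+ 2 = 4 * t by rewrite sqr_sqrtr ?mulr_ge0 ?(ltW t0)// -mulr_natr; ring.
have kE y : gauss_kernel t (x - y) = k * gauss s (x - y).
  by rewrite /gauss_kernel /gauss s2.
have ig := integrable_gauss_transform x s0 cf if0 finf.
have gE : (fun y => ((gauss_kernel t (x - y))%:E * (if 0 < y then f y else 0)%:E)%E) =
    ((fun y => (k * (gauss s (x - y) * f y))%:E) \_ `]0, +oo[).
  apply/funext => y; rewrite patchE mem_setE in_itv/= andbT kE -EFinM.
  by case: ifPn => _; rewrite ?mulr0// mulrA.
rewrite /conv_gauss ge0_integral_density; last 2 first.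
- apply/measurable_EFinP; under eq_fun do rewrite kE.
  apply: measurable_funM => //; apply: continuous_measurable_fun => y.
  exact: continuous_gauss.
- by move=> y; rewrite lee_fin kE mulr_ge0 ?invr_ge0 ?sqrtr_ge0 ?gauss_ge0.
rewrite gE -integral_mkcond /gauss_transform.
rewrite -RintegralZl// /Rintegral fineK//; apply: integrable_fin_num => //.
by have := integrableZl _ k ig; apply.
Qed.

Lemma whale_shaped_weakly_bell_shaped (R : realType) (m : nat) (f : R -> R) :
  whale_shaped m f -> (m = 0%N -> integrable_near0 f) ->
  weakly_bell_shaped_fun (fun x : R => if 0 < x then f x else 0).
Proof.
move=> wf if0; have W := whale_shaped_family wf.
have [fpos sf finf fl _] := wf.
have [dW _ _ _ _] := W.
have cf (x : R) : 0 < x -> {for x, continuous f}.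
  move=> x0; have Ix : `]0, +oo[%classic x by rewrite pos_itv.
  by have h := dW 0%N x Ix; exact: (is_derive_continuous h).
(* In positive order [f] tends to zero at 0, hence is bounded there. *)
have i0 : integrable_near0 f.
  case: m fl if0 {wf W} => [_|m fl _]; first exact.
  by apply: integrable_near0_cvg0 => //; exact: (fl 0%N).
have g0 (x : R) : 0 <= (if 0 < x then f x else 0).
  by case: ifPn => // /fpos/ltW.
have mg : measurable_fun (setT : set (measurableTypeR R)) (fun x => if 0 < x then f x else 0).
  have -> : (fun x => if 0 < x then f x else 0) = f \_ `]0, +oo[.
    by apply/funext => x; rewrite patchE mem_setE in_itv/= andbT.
  apply/(measurable_restrictT _ _).1 => //.
  exact: continuous_pos_measurable.
exists (density_measure (@lebesgue_measure R) g0 mg); first by split.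
move=> t t0; have cE x := conv_gauss_density x g0 mg t0 cf i0 finf.
split; first by move=> x; rewrite cE.
under eq_fun do rewrite cE/=.
set s := Num.sqrt (2 * t); set k := (Num.sqrt (4 * pi * t))^-1.
have s0 : 0 < s by rewrite sqrtr_gt0 mulr_gt0.
have sn0 : s != 0 by rewrite gt_eqF.
have k0 : 0 < k by rewrite invr_gt0 sqrtr_gt0 !mulr_gt0 ?pi_gt0.
have [D dD D0] := gauss_transform_family sn0 cf i0 finf.
have dkD : der_family setT (fun n x => k * D n x).
  move=> n x _; have h := is_deriveM (is_derive_cst k x 1) (dD n x I).
  by apply: is_derive_eq h _; rewrite /GRing.scale/= mulr0 addr0.
have -> : (fun x => k * gauss_transform s f x) = (fun n x => k * D n x) 0%N.
  by rewrite D0.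
apply: (strictly_bell_shaped_family (D := fun n x => k * D n x) dkD).
- by move=> x; rewrite D0 mulr_gt0// gauss_transform_gt0.
- by apply: cvg0M; rewrite D0; exact: gauss_transform_cvg_pinfty.
- by apply: cvg0M; rewrite D0; exact: gauss_transform_cvg_ninfty.
- move=> n u alt; apply: (@gauss_transform_upper _ _ _ D s n u s0 W i0 dD D0).
  by apply: (alternates_mulpos (w := fun=> k) _ _ _ _).1 alt.
Qed.

Theorem theorem1p13 (R : realType) (m : nat) (f : R -> R) :
  ((whale_shaped m f /\ (m = 0%N -> integrable_near0 f)) <->
   (exists (alpha : m.-tuple R) (g : R -> R),
      [/\ forall j : 'I_m, 0 < tnth alpha j,
          completely_monotone g,
          exists2 x : R, 0 < x & g x != 0,
          g x @[x --> +oo] --> (0 : R) /\ integrable_near0 g &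
          forall x : R, 0 < x -> f x = conv_exp_factors alpha g x])) /\
  (whale_shaped m f -> (m = 0%N -> integrable_near0 f) ->
   weakly_bell_shaped_fun (fun x : R => if 0 < x then f x else 0)).
Proof.
by split; [exact: whale_shaped_iff|exact: whale_shaped_weakly_bell_shaped].
Qed.
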